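(* For every $\alpha\in[1/2,3/4]$, \[ \dim_{\mathcal{H}}\phi(D_{\alpha}) \leq \dim_{\mathcal{H}}\bigcup_{\beta \leq \alpha}\phi(D_{\beta}) \leq \frac{4\alpha - 2}{\alpha}. \]
   Context: $\phi(t) = \sum_{k \in \mathbb{Z}} \frac{ e^{-4\pi^2 i k^2 t} - 1 }{-4\pi^2 k^2}$ for $t\in\mathbb{R}$, where the $k=0$ term is interpreted as its limit value $it$. For $\alpha>0$ and $x_0\in\mathbb{R}$, we write $\phi\in C^\alpha(x_0)$ if there exist a polynomial $P$ (with complex coefficients) of degree at most $\alpha$ and a constant $C>0$ such that $|\phi(x_0+h)-P(h)|\leq C|h|^\alpha$ for all sufficiently small $|h|$. The Hölder exponent of $\phi$ at $x_0$ is $\alpha(x_0)=\sup\{\alpha : \phi\in C^\alpha(x_0)\}$, and for $\beta\in\mathbb{R}$, $D_\beta=\{x\in\mathbb{R} : \alpha(x)=\beta\}$. $\dim_{\mathcal{H}}$ denotes Hausdorff dimension. *)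

(* Defs.v *)
From Stdlib Require Import Reals Lra ZArith ClassicalEpsilon.
Open Scope R_scope.

Definition C : Type := (R * R)%type.
Definition cnorm (z : C) : R := sqrt (fst z * fst z + snd z * snd z).
Definition cdist (z w : C) : R := cnorm (fst z - fst w, snd z - snd w).

(* Power with the convention 0^a = 0 for a > 0 (Stdlib's Rpower 0 a = 1). *)
Definition rpow (x a : R) : R := if Req_EM_T x 0 then 0 else Rpower x a.

Definition seq_lim (u : nat -> R) : R := epsilon (inhabits 0) (fun l => Un_cv u l).

(* k-th term of the series: (e^{-4 pi^2 i k^2 t} - 1)/(-4 pi^2 k^2),
   with the k = 0 term equal to i t.  e^{-i th} = cos th - i sin th. *)
Definition phi_term (k : Z) (t : R) : C :=
  if Z.eqb k 0 then (0, t)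
  else let th := 4 * PI ^ 2 * (IZR k) ^ 2 * t in
       let d := - (4 * PI ^ 2 * (IZR k) ^ 2) in
       ((cos th - 1) / d, (- sin th) / d).

(* Symmetric partial sums  sum_{|k| <= N} *)
Definition phi_block (n : nat) (t : R) : C :=
  if Nat.eqb n 0 then phi_term 0 t
  else (fst (phi_term (Z.of_nat n) t) + fst (phi_term (- Z.of_nat n)%Z t),
        snd (phi_term (Z.of_nat n) t) + snd (phi_term (- Z.of_nat n)%Z t)).

Definition phi (t : R) : C :=
  (seq_lim (fun N => sum_f_R0 (fun n => fst (phi_block n t)) N),
   seq_lim (fun N => sum_f_R0 (fun n => snd (phi_block n t)) N)).

Definition cpoly (c : nat -> C) (N : nat) (h : R) : C :=
  (sum_f_R0 (fun j => fst (c j) * h ^ j) N, sum_f_R0 (fun j => snd (c j) * h ^ j) N).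

Definition holder_at (f : R -> C) (x0 alpha : R) : Prop :=
  exists (c : nat -> C) (N : nat) (K delta : R),
    INR N <= alpha /\ 0 < K /\ 0 < delta /\
    forall h, Rabs h < delta ->
      cdist (f (x0 + h)) (cpoly c N h) <= K * rpow (Rabs h) alpha.

Definition D (f : R -> C) (beta : R) (x : R) : Prop :=
  is_lub (fun a => 0 < a /\ holder_at f x a) beta.

(* Hausdorff measure H^s(E) = 0 : for every delta > 0, H^s_delta(E) = 0,
   i.e. E admits countable delta-covers with arbitrarily small sum of diam^s. *)
Definition diam_le (U : C -> Prop) (d : R) : Prop :=
  forall z w, U z -> U w -> cdist z w <= d.

Definition hausdorff_null (s : R) (E : C -> Prop) : Prop :=
  forall delta eps, 0 < delta -> 0 < eps ->
    exists (U : nat -> C -> Prop) (r : nat -> R),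
      (forall z, E z -> exists i, U i z) /\
      (forall i, 0 <= r i <= delta /\ diam_le (U i) (r i)) /\
      (forall n, sum_f_R0 (fun i => rpow (r i) s) n <= eps).

Definition is_glb (P : R -> Prop) (m : R) : Prop :=
  (forall x, P x -> m <= x) /\ (forall b, (forall x, P x -> b <= x) -> b <= m).

Definition hausdorff_dim (E : C -> Prop) : R :=
  epsilon (inhabits 0) (is_glb (fun s => 0 < s /\ hausdorff_null s E)).

Definition image (f : R -> C) (A : R -> Prop) : C -> Prop :=
  fun z => exists x, A x /\ z = f x.

(* Main.v *)
(** Write [x = 2 pi t], so that [phi] is [i t] plus a multiple of the sum over [n >= 1] of
    [(1 - e(- n^2 x)) / n^2], where [e(u) = exp(2 pi i u)].

    Weyl's bound for [sum_{n<M} e(n^2 y)] at [|y - P/Q| <= 1/Q^2] shows: if [T^2 r <= 1] and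
    every [y] between [x] and [x'], [|x - x'| <= r], has such an approximation with
    [T/2 <= Q <= 2/(r T)], then [phi] varies by at most [(r / T)^(1/2)] up to logarithms.
    Frequencies below [r^(-1/2)] are treated with the mean value theorem, the others by Abel
    summation.  With [r = T^(-tau)] and [tau >= 2] this is used twice:
    - if [|x - p/q| > q^(-tau)] for all large [q], then [phi] is Hoelder at [x] with any
      exponent below [1/2 + 1/(2 tau)];
    - the image of [{|x - p/q| <= q^(-tau)}] has diameter at most [q^(-(tau+1)/2)], up to
      [q^epsilon].
    So points of exponent at most [alpha] are covered, apart from the rationals, by the latter
    intervals for every [tau < 1/(2 alpha - 1)] (for [alpha = 3/4] by Dirichlet's theorem with
    [tau = 2]), and the covering sum converges for
    [s > 4/(tau+1)], which tends to [(4 alpha - 2)/alpha]. *)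
Require Import Defs.
From Stdlib Require Import Reals Lra Lia ZArith Znumtheory Classical ClassicalEpsilon.
From Stdlib Require Cantor.
Open Scope R_scope.

(** * Finite sums and Weyl's bound *)

Fixpoint Sum (f : nat -> R) (n : nat) : R :=
  match n with O => 0 | S m => Sum f m + f m end.

Lemma Sum_ext (f g : nat -> R) n :
  (forall k, (k < n)%nat -> f k = g k) -> Sum f n = Sum g n.
Proof.
  induction n as [|n IH]; intros H; simpl; [reflexivity|].
  rewrite IH by (intros; apply H; lia). rewrite H by lia. reflexivity.
Qed.

Lemma Sum_le (f g : nat -> R) n :
  (forall k, (k < n)%nat -> f k <= g k) -> Sum f n <= Sum g n.
Proof.
  induction n as [|n IH]; intros H; simpl; [lra|].
  apply Rplus_le_compat; [apply IH; intros; apply H; lia | apply H; lia].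
Qed.

Lemma Sum_plus (f g : nat -> R) n : Sum (fun k => f k + g k) n = Sum f n + Sum g n.
Proof. induction n as [|n IH]; simpl; [lra|]. rewrite IH. lra. Qed.

Lemma Sum_scal (a : R) (f : nat -> R) n : Sum (fun k => a * f k) n = a * Sum f n.
Proof. induction n as [|n IH]; simpl; [lra|]. rewrite IH. lra. Qed.

Lemma Sum_const (a : R) n : Sum (fun _ => a) n = INR n * a.
Proof. induction n as [|n IH]; [simpl; lra|]. rewrite S_INR. cbn [Sum]. rewrite IH. lra. Qed.

Lemma Sum_abs (f : nat -> R) n : Rabs (Sum f n) <= Sum (fun k => Rabs (f k)) n.
Proof.
  induction n as [|n IH]; simpl; [rewrite Rabs_R0; lra|].
  eapply Rle_trans; [apply Rabs_triang|]. lra.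
Qed.

Lemma Sum_ge0 (f : nat -> R) n : (forall k, (k < n)%nat -> 0 <= f k) -> 0 <= Sum f n.
Proof.
  intros H. replace 0 with (Sum (fun _ => 0) n) by (rewrite Sum_const; lra).
  apply Sum_le, H.
Qed.

Lemma Sum_split (f : nat -> R) n m : Sum f (n + m) = Sum f n + Sum (fun k => f (n + k)%nat) m.
Proof.
  induction m as [|m IH]; [rewrite Nat.add_0_r; simpl; lra|].
  rewrite Nat.add_succ_r. simpl. rewrite IH. lra.
Qed.

Lemma Sum_recl (f : nat -> R) n : Sum f (S n) = f O + Sum (fun k => f (S k)) n.
Proof. change (S n) with (1 + n)%nat. rewrite (Sum_split f 1 n). simpl. lra. Qed.

Lemma Sum_le_mono (f : nat -> R) n m :
  (n <= m)%nat -> (forall k, 0 <= f k) -> Sum f n <= Sum f m.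
Proof.
  intros H Hf. replace m with (n + (m - n))%nat by lia. rewrite Sum_split.
  assert (0 <= Sum (fun k => f (n + k)%nat) (m - n)) by (apply Sum_ge0; auto). lra.
Qed.

Lemma Sum_rev (f : nat -> R) n : Sum (fun k => f (n - 1 - k)%nat) n = Sum f n.
Proof.
  induction n as [|n IH]; [reflexivity|].
  rewrite Sum_recl. cbn [Sum]. replace (S n - 1 - 0)%nat with n by lia.
  rewrite <- IH. rewrite Rplus_comm. f_equal. apply Sum_ext. intros k Hk. f_equal. lia.
Qed.

Lemma sum_f_R0_Sum (f : nat -> R) n : sum_f_R0 f n = Sum f (S n).
Proof. induction n as [|n IH]; simpl in *; [lra|]. rewrite IH. lra. Qed.

Lemma Sum_remove (f : nat -> R) i n :
  (i < n)%nat -> Sum f n = Sum (fun k => if Nat.eq_dec k i then 0 else f k) n + f i.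
Proof.
  induction n as [|n IH]; intros H; [lia|]. simpl.
  destruct (Nat.eq_dec n i) as [->|Hn].
  - rewrite Rplus_0_r. f_equal. apply Sum_ext. intros k Hk.
    destruct (Nat.eq_dec k i); [lia|reflexivity].
  - rewrite IH by lia. lra.
Qed.

(** Induction on [n]: setting [f] to zero at [g n] leaves the other sampled values unchanged by
    injectivity. This is why [f] is quantified after [n]. *)
Lemma Sum_injective_le (g : nat -> nat) (m n : nat) : forall f : nat -> R,
  (forall k, 0 <= f k) ->
  (forall k, (k < n)%nat -> (g k < m)%nat) ->
  (forall k l, (k < n)%nat -> (l < n)%nat -> g k = g l -> k = l) ->
  Sum (fun k => f (g k)) n <= Sum f m.
Proof.
  induction n as [|n IH]; intros f Hf Hg Hinj; simpl.
  - apply Sum_ge0; auto.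
  - rewrite (Sum_remove f (g n) m) by (apply Hg; lia).
    apply Rplus_le_compat_r.
    eapply Rle_trans; [|apply (IH (fun k => if Nat.eq_dec k (g n) then 0 else f k))].
    + apply Sum_le. intros k Hk. destruct (Nat.eq_dec (g k) (g n)) as [e|]; [|lra].
      apply Hinj in e; lia.
    + intros k. destruct (Nat.eq_dec k (g n)); [lra|auto].
    + intros k Hk. apply Hg. lia.
    + intros k l Hk Hl. apply Hinj; lia.
Qed.

Lemma Sum_block_le (d : nat -> R) (G : R) (K J : nat) :
  (forall a, Sum (fun k => d (a + k)%nat) K <= G) -> Sum d (J * K) <= INR J * G.
Proof.
  intros H. induction J as [|J IH]; [simpl; lra|].
  replace (S J * K)%nat with (J * K + K)%nat by lia.
  rewrite Sum_split, S_INR. specialize (H (J * K)%nat). lra.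
Qed.

Lemma harmonic_le (n : nat) : (1 <= n)%nat -> Sum (fun k => / INR (S k)) n <= 1 + ln (INR n).
Proof.
  induction n as [|n IH]; intros H; [lia|]. destruct n as [|n].
  - simpl. rewrite ln_1. lra.
  - cbn [Sum] in *. specialize (IH ltac:(lia)).
    assert (H1 : 0 < INR (S n)) by (apply lt_0_INR; lia).
    assert (H2 : INR (S (S n)) = INR (S n) + 1) by (rewrite (S_INR (S n)); lra).
    (* [ln (m / (m+1)) <= m / (m+1) - 1] *)
    assert (H3 : ln (INR (S n) / INR (S (S n))) <= - / INR (S (S n))).
    { assert (Hy : 0 < INR (S n) / INR (S (S n))) by (apply Rdiv_lt_0_compat; lra).
      pose proof (exp_ineq1_le (ln (INR (S n) / INR (S (S n))))) as E.
      rewrite exp_ln in E by exact Hy.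
      replace (INR (S n) / INR (S (S n))) with (1 - / INR (S (S n))) in E at 2
        by (rewrite H2; field; lra).
      lra. }
    unfold Rdiv in H3. rewrite ln_mult, ln_Rinv in H3; try lra.
    apply Rinv_0_lt_compat; lra.
Qed.

(** Telescoping of [2 sin(v/2) cos u = sin(u + v/2) - sin(u - v/2)]. The product form remains valid
    when [sin(v/2)] vanishes. *)
Lemma cos_progression_sum (a v : R) (K : nat) :
  2 * sin (v / 2) * Sum (fun n => cos (a + INR n * v)) K
  = sin (a + (INR K - 1 / 2) * v) - sin (a - v / 2).
Proof.
  induction K as [|K IH].
  - simpl. replace (a + (0 - 1 / 2) * v) with (a - v / 2) by lra. lra.
  - cbn [Sum]. rewrite S_INR, Rmult_plus_distr_l, IH.
    replace (a + (INR K - 1 / 2) * v) with ((a + INR K * v) - v / 2) by lra.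
    replace (a + (INR K + 1 - 1 / 2) * v) with ((a + INR K * v) + v / 2) by lra.
    rewrite sin_plus, (sin_minus (a + INR K * v)). lra.
Qed.

Lemma cos_progression_sum_sin_le (a v : R) (K : nat) :
  Rabs (sin (v / 2)) * Rabs (Sum (fun n => cos (a + INR n * v)) K) <= 1.
Proof.
  rewrite <- Rabs_mult.
  pose proof (cos_progression_sum a v K) as E.
  pose proof (SIN_bound (a + (INR K - 1 / 2) * v)).
  pose proof (SIN_bound (a - v / 2)).
  apply Rabs_le. nra.
Qed.

Lemma cos_sum_trivial_bound (u : nat -> R) (K : nat) : Rabs (Sum (fun n => cos (u n)) K) <= INR K.
Proof.
  eapply Rle_trans; [apply Sum_abs|].
  rewrite <- (Rmult_1_r (INR K)), <- Sum_const. apply Sum_le. intros k _.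
  pose proof (COS_bound (u k)). apply Rabs_le. lra.
Qed.

(** Expansion of the squared modulus of the sum of [exp(i u_n)]: the diagonal gives [M], and
    conjugate pairs are grouped by the index difference [l + 1]. For quadratic phases each inner sum
    then runs over an arithmetic progression. *)
Lemma weyl_differencing (u : nat -> R) (M : nat) :
  (Sum (fun n => cos (u n)) M) ^ 2 + (Sum (fun n => sin (u n)) M) ^ 2
  = INR M + 2 * Sum (fun l => Sum (fun n => cos (u (n + S l)%nat - u n)) (M - 1 - l)) M.
Proof.
  induction M as [|M IH]; [simpl; lra|].
  set (A := Sum (fun n => cos (u n)) M) in *. set (B := Sum (fun n => sin (u n)) M) in *.
  cbn [Sum]. rewrite S_INR.
  replace (S M - 1 - M)%nat with O by lia. cbn [Sum]. fold A B.
  assert (E : Sum (fun l => Sum (fun n => cos (u (n + S l)%nat - u n)) (S M - 1 - l)) M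
     = Sum (fun l => Sum (fun n => cos (u (n + S l)%nat - u n)) (M - 1 - l)) M
       + (cos (u M) * A + sin (u M) * B)).
  { unfold A, B. rewrite <- !Sum_scal, <- Sum_plus.
    rewrite <- (Sum_rev (fun k => cos (u M) * cos (u k) + sin (u M) * sin (u k))), <- Sum_plus.
    apply Sum_ext. intros l Hl.
    replace (S M - 1 - l)%nat with (S (M - 1 - l)) by lia. cbn [Sum].
    replace (M - 1 - l + S l)%nat with M by lia. rewrite cos_minus. lra. }
  rewrite E. pose proof (sin2_cos2 (u M)) as T. unfold Rsqr in T. nra.
Qed.

Lemma sin_ge_third (x : R) : 0 <= x <= 2 -> x / 3 <= sin x.
Proof.
  intros H. destruct (pre_sin_bound x 0) as [Hs _]; [lra|lra|].
  unfold sin_approx, sin_term in Hs. simpl in Hs.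
  assert (x * x <= 4) by nra. nra.
Qed.

Lemma Rabs_sin_add_IZR_PI (x : R) (k : Z) : Rabs (sin (x + IZR k * PI)) = Rabs (sin x).
Proof.
  rewrite sin_plus.
  assert (S0 : sin (IZR k * PI) = 0) by (apply sin_eq_0_1; exists k; reflexivity).
  pose proof (sin2_cos2 (IZR k * PI)) as T. rewrite S0 in *. unfold Rsqr in T.
  rewrite Rmult_0_r, Rplus_0_r, Rabs_mult.
  assert (Rabs (cos (IZR k * PI)) = 1).
  { pose proof (Rabs_pos (cos (IZR k * PI))).
    assert (Rabs (cos (IZR k * PI)) * Rabs (cos (IZR k * PI)) = 1)
      by (rewrite <- Rabs_mult, Rabs_pos_eq; nra).
    nra. }
  nra.
Qed.

Lemma frac_part_bounds (u : R) : 0 <= frac_part u < 1.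
Proof. pose proof (base_fp u). lra. Qed.

(** The left side is the distance from [u] to the nearest integer. After reduction modulo the period
    [PI] of [|sin|], the bound [sin x >= x / 3] on [[0, 2]] suffices because [3 < PI <= 4]. *)
Lemma Rabs_sin_PI_ge (u : R) :
  Rmin (frac_part u) (1 - frac_part u) <= Rabs (sin (PI * u)).
Proof.
  pose proof (frac_part_bounds u) as Hw.
  replace (PI * u) with (PI * frac_part u + IZR (Int_part u) * PI)
    by (unfold frac_part; ring).
  rewrite Rabs_sin_add_IZR_PI. set (w := frac_part u) in *.
  pose proof PI2_3_2. pose proof PI_4.
  eapply Rle_trans; [|apply Rle_abs].
  destruct (Rle_dec w (1 / 2)).
  - rewrite Rmin_left by lra. pose proof (sin_ge_third (PI * w)). nra.
  - rewrite Rmin_right by lra. pose proof (sin_ge_third (PI * (1 - w))) as E.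
    replace (sin (PI * w)) with (sin (PI * (1 - w))); [nra|].
    rewrite <- (sin_PI_x (PI * w)). f_equal. ring.
Qed.

Definition nfloor (x : R) : nat := Z.to_nat (Int_part x).

Lemma nfloor_bounds (x : R) : 0 <= x -> INR (nfloor x) <= x < INR (nfloor x) + 1.
Proof.
  intros H. destruct (base_Int_part x) as [H1 H2]. unfold nfloor.
  assert (0 <= Int_part x)%Z.
  { apply Z.lt_succ_r. apply lt_IZR. rewrite succ_IZR. lra. }
  rewrite INR_IZR_INZ, Z2Nat.id by assumption. lra.
Qed.

(* The arc of length [1/(2q)] containing [2lx] modulo 1. *)
Definition bucket (q : nat) (x : R) (l : nat) : nat :=
  nfloor (2 * INR q * frac_part (2 * INR l * x)).

Lemma bucket_bounds (q : nat) (x : R) (l : nat) :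
  INR (bucket q x l) <= 2 * INR q * frac_part (2 * INR l * x) < INR (bucket q x l) + 1.
Proof.
  apply nfloor_bounds. pose proof (frac_part_bounds (2 * INR l * x)).
  pose proof (pos_INR q). nra.
Qed.

Lemma bucket_lt (q : nat) (x : R) (l : nat) : (0 < q)%nat -> (bucket q x l < 2 * q)%nat.
Proof.
  intros Hq. pose proof (bucket_bounds q x l). pose proof (frac_part_bounds (2 * INR l * x)).
  apply lt_0_INR in Hq. apply INR_lt. rewrite mult_INR. simpl. nra.
Qed.

(** With [d = m - l], a common arc puts [2dx] within [1/(2q)] of an integer [a], and replacing [x]
    by [p/q] costs at most another [1/(2q)]. So the integer [2dp - aq] is below 1 in modulus and
    vanishes; then [q] divides [2d <= q/2], which forces [d = 0]. *)
Lemma bucket_inj (q : nat) (p : Z) (x : R) (l m : nat) :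
  (0 < q)%nat -> rel_prime p (Z.of_nat q) ->
  Rabs (x - IZR p / INR q) <= / (INR q * INR q) ->
  (l <= m)%nat -> (4 * (m - l) <= q)%nat ->
  bucket q x l = bucket q x m -> l = m.
Proof.
  intros Hq Hpq Hx Hlm Hd E.
  assert (Hq' : 0 < INR q) by (apply lt_0_INR; lia).
  pose proof (bucket_bounds q x l) as B1. pose proof (bucket_bounds q x m) as B2.
  rewrite E in B1.
  set (a := (Int_part (2 * INR m * x) - Int_part (2 * INR l * x))%Z).
  set (d := (m - l)%nat).
  assert (Hdm : INR m = INR l + INR d) by (rewrite <- plus_INR; f_equal; lia).
  assert (H1 : Rabs (2 * INR q * (2 * INR d * x - IZR a)) < 1).
  { unfold frac_part in *. unfold a. rewrite minus_IZR. apply Rabs_def1; rewrite Hdm in *; lra. }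
  assert (Hd' : 4 * INR d <= INR q).
  { replace 4 with (INR 4) by (simpl; lra).
    rewrite <- mult_INR. apply le_INR. lia. }
  pose proof (pos_INR d) as Hd0.
  assert (H2 : Rabs (INR q * INR d * 4 * (x - IZR p / INR q)) <= 1).
  { rewrite Rabs_mult, (Rabs_pos_eq (INR q * INR d * 4)) by nra.
    apply Rle_trans with (INR q * INR d * 4 * / (INR q * INR q)).
    - apply Rmult_le_compat_l; [nra|exact Hx].
    - replace (INR q * INR d * 4 * / (INR q * INR q)) with (4 * INR d / INR q) by (field; lra).
      apply Rmult_le_reg_r with (INR q); [lra|]. field_simplify; lra. }
  assert (H3 : Rabs (2 * (2 * INR d * IZR p - IZR a * INR q)) < 2).
  { replace (2 * (2 * INR d * IZR p - IZR a * INR q))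
      with (2 * INR q * (2 * INR d * x - IZR a) - INR q * INR d * 4 * (x - IZR p / INR q))
      by (field; lra).
    eapply Rle_lt_trans; [apply Rabs_triang|]. rewrite Rabs_Ropp. lra. }
  assert (H4 : (2 * Z.of_nat d * p - a * Z.of_nat q = 0)%Z).
  { apply Rabs_def2 in H3.
    assert (-1 < IZR (2 * Z.of_nat d * p - a * Z.of_nat q) < 1).
    { rewrite minus_IZR, !mult_IZR, <- !INR_IZR_INZ. lra. }
    assert (-1 < 2 * Z.of_nat d * p - a * Z.of_nat q < 1)%Z
      by (split; apply lt_IZR; lra).
    lia. }
  assert (H5 : (Z.of_nat q | 2 * Z.of_nat d)%Z).
  { apply Gauss with p; [exists a; lia|]. apply rel_prime_sym, Hpq. }
  destruct (Nat.eq_dec d 0); [lia|].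
  apply Z.divide_pos_le in H5; lia.
Qed.

(** Bound for a cosine progression whose frequency lies in arc [b]: the trivial bound on the arc at
    0, elsewhere the reciprocal of the least distance [b/(2q)] to 0. *)
Definition bucket_weight (M q b : nat) : R :=
  match b with O => INR M | S _ => 2 * INR q / INR b end.

Lemma bucket_weight_ge0 (M q b : nat) : 0 <= bucket_weight M q b.
Proof.
  pose proof (pos_INR M). pose proof (pos_INR q). destruct b; cbn [bucket_weight]; [assumption|].
  apply Rmult_le_pos; [lra|]. left. apply Rinv_0_lt_compat, lt_0_INR. lia.
Qed.

Lemma bucket_weight_sum (M q : nat) : (0 < q)%nat ->
  Sum (bucket_weight M q) (2 * q) <= INR M + 2 * INR q * (1 + ln (2 * INR q)).
Proof.
  intros Hq. replace (2 * q)%nat with (S (2 * q - 1)) by lia.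
  rewrite Sum_recl. change (bucket_weight M q 0) with (INR M). apply Rplus_le_compat_l.
  rewrite (Sum_ext _ (fun k => 2 * INR q * / INR (S k))) by reflexivity.
  rewrite Sum_scal. pose proof (pos_INR q). apply Rmult_le_compat_l; [lra|].
  eapply Rle_trans; [apply harmonic_le; lia|]. apply Rplus_le_compat_l.
  assert (INR (2 * q - 1) <= 2 * INR q).
  { replace (2 * INR q) with (INR (2 * q)) by (rewrite mult_INR; simpl; lra). apply le_INR. lia. }
  assert (0 < INR (2 * q - 1)) by (apply lt_0_INR; lia).
  destruct (Req_dec (INR (2 * q - 1)) (2 * INR q)) as [->|]; [lra|].
  left. apply ln_increasing; lra.
Qed.

(** The integer nearest to [2lx] may lie on either side, so both the arc and its mirror image
    [2q - 1 - b] are charged. *)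
Definition bucket_bound (M q : nat) (x : R) (l : nat) : R :=
  bucket_weight M q (bucket q x l) + bucket_weight M q (2 * q - 1 - bucket q x l).

Lemma progression_le_bucket_bound (M q l K : nat) (x a : R) :
  (0 < q)%nat -> (K <= M)%nat ->
  Rabs (Sum (fun n => cos (a + INR n * (4 * PI * INR l * x))) K) <= bucket_bound M q x l.
Proof.
  intros Hq HK. unfold bucket_bound.
  pose proof (bucket_lt q x l Hq) as Hb. pose proof (bucket_bounds q x l) as B.
  pose proof (cos_progression_sum_sin_le a (4 * PI * INR l * x) K) as H1.
  replace (4 * PI * INR l * x / 2) with (PI * (2 * INR l * x)) in H1 by field.
  pose proof (Rabs_sin_PI_ge (2 * INR l * x)) as H2.
  pose proof (cos_sum_trivial_bound (fun n => a + INR n * (4 * PI * INR l * x)) K) as H3.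
  apply le_INR in HK.
  pose proof (bucket_weight_ge0 M q (bucket q x l)) as W1.
  pose proof (bucket_weight_ge0 M q (2 * q - 1 - bucket q x l)) as W2.
  set (b := bucket q x l) in *. set (w := frac_part (2 * INR l * x)) in *.
  set (V := Rabs (Sum _ K)) in *. set (s := Rabs (sin _)) in *.
  assert (Hq' : 0 < INR q) by (apply lt_0_INR; lia).
  assert (HV : 0 <= V) by apply Rabs_pos.
  destruct b as [|b'] eqn:Eb; [cbn [bucket_weight] in *; lra|].
  destruct (2 * q - 1 - S b')%nat as [|c'] eqn:Ec; [cbn [bucket_weight] in *; lra|].
  cbn [bucket_weight] in *.
  assert (Hc : INR (S c') = 2 * INR q - 1 - INR (S b')).
  { rewrite <- Ec, !minus_INR, mult_INR by lia. simpl. lra. }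
  assert (0 < INR (S b')) by (apply lt_0_INR; lia).
  assert (0 < INR (S c')) by (apply lt_0_INR; lia).
  assert (key : forall y, 0 < y -> y / (2 * INR q) <= s -> V <= 2 * INR q / y).
  { intros y Hy Hs. apply Rmult_le_reg_r with y; [lra|].
    replace (2 * INR q / y * y) with (2 * INR q) by (field; lra).
    assert (y <= s * (2 * INR q)).
    { apply Rmult_le_compat_r with (r := 2 * INR q) in Hs; [|lra].
      field_simplify in Hs; lra. }
    nra. }
  assert (w * (2 * INR q) >= INR (S b') /\ (1 - w) * (2 * INR q) >= INR (S c')) as [G1 G2] by (split; nra).
  unfold Rmin in H2. destruct (Rle_dec w (1 - w)).
  - specialize (key (INR (S b')) ltac:(lra)).
    assert (INR (S b') / (2 * INR q) <= s); [|specialize (key H4); lra].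
    apply Rle_trans with w; [|lra]. apply Rmult_le_reg_r with (2 * INR q); [lra|].
    field_simplify; lra.
  - specialize (key (INR (S c')) ltac:(lra)).
    assert (INR (S c') / (2 * INR q) <= s); [|specialize (key H4); lra].
    apply Rle_trans with (1 - w); [|lra]. apply Rmult_le_reg_r with (2 * INR q); [lra|].
    field_simplify; lra.
Qed.

(** Indices in such a block differ by at most [q/4], so they occupy distinct arcs by [bucket_inj].
    Each arc is thus charged at most once directly and once through its mirror image. *)
Lemma bucket_bound_block (M q : nat) (p : Z) (x : R) (a : nat) :
  (0 < q)%nat -> rel_prime p (Z.of_nat q) ->
  Rabs (x - IZR p / INR q) <= / (INR q * INR q) ->
  Sum (fun k => bucket_bound M q x (S (a + k))) (q / 4 + 1)
  <= 2 * (INR M + 2 * INR q * (1 + ln (2 * INR q))).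
Proof.
  intros Hq Hpq Hx. unfold bucket_bound. rewrite Sum_plus.
  pose proof (bucket_weight_sum M q Hq).
  assert (Hinj : forall k l, (k < q / 4 + 1)%nat -> (l < q / 4 + 1)%nat ->
     bucket q x (S (a + k)) = bucket q x (S (a + l)) -> k = l).
  { intros k l Hk Hl E. pose proof (Nat.Div0.mul_div_le q 4).
    destruct (Nat.le_ge_cases k l).
    - apply (bucket_inj q p) in E; auto; lia.
    - symmetry in E. apply (bucket_inj q p) in E; auto; lia. }
  assert (H1 : Sum (fun k => bucket_weight M q (bucket q x (S (a + k)))) (q / 4 + 1)
          <= Sum (bucket_weight M q) (2 * q)).
  { apply (Sum_injective_le (fun k => bucket q x (S (a + k)))); auto.
    - apply bucket_weight_ge0.
    - intros. apply bucket_lt, Hq. }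
  assert (H2 : Sum (fun k => bucket_weight M q (2 * q - 1 - bucket q x (S (a + k)))) (q / 4 + 1)
          <= Sum (bucket_weight M q) (2 * q)).
  { apply (Sum_injective_le (fun k => (2 * q - 1 - bucket q x (S (a + k)))%nat)); auto.
    - apply bucket_weight_ge0.
    - intros. lia.
    - intros k l Hk Hl E. apply Hinj; auto.
      pose proof (bucket_lt q x (S (a + k)) Hq). pose proof (bucket_lt q x (S (a + l)) Hq). lia. }
  lra.
Qed.

(** Index [n] stands for the frequency [n + 1]. The shift [c] lets one family of cosine sums also
    cover sines ([c = - PI/2]) and derivatives ([c + PI/2]). *)
Definition quad_phase (x c : R) (n : nat) : R := 2 * PI * INR (S n) ^ 2 * x + c.

Lemma weyl_bound (M q : nat) (p : Z) (x c : R) :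
  (0 < q)%nat -> rel_prime p (Z.of_nat q) ->
  Rabs (x - IZR p / INR q) <= / (INR q * INR q) ->
  (Sum (fun n => cos (quad_phase x c n)) M) ^ 2
  <= 40 * (1 + ln (2 * INR q)) * (INR M ^ 2 / INR q + INR M + INR q).
Proof.
  intros Hq Hpq Hx.
  pose proof (weyl_differencing (quad_phase x c) M) as E.
  assert (Hq1 : 1 <= INR q) by (apply (le_INR 1); lia).
  assert (HM : 0 <= INR M) by apply pos_INR.
  assert (HL : 0 <= ln (2 * INR q)) by (rewrite <- ln_1; left; apply ln_increasing; lra).
  set (L := 1 + ln (2 * INR q)).
  set (J := (M / (q / 4 + 1) + 1)%nat).
  assert (H1 : Sum (fun l => Sum (fun n => cos (quad_phase x c (n + S l) - quad_phase x c n))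
                 (M - 1 - l)) M <= INR J * (2 * (INR M + 2 * INR q * L))).
  { apply Rle_trans with (Sum (fun l => bucket_bound M q x (S l)) M).
    - apply Sum_le. intros l Hl. eapply Rle_trans; [apply Rle_abs|].
      (* The difference of the phases at [n + S l] and [n] is affine in [n], with slope
         [4 PI (l+1) x] and the constant term [a] given here. *)
      erewrite Sum_ext; [apply progression_le_bucket_bound with (l := S l)
        (a := 2 * PI * x * (INR (S l) ^ 2 + 2 * INR (S l))); [exact Hq|lia]|].
      intros n _. cbv beta. f_equal. unfold quad_phase. rewrite !S_INR, plus_INR, !S_INR. ring.
    - apply Rle_trans with (Sum (fun l => bucket_bound M q x (S l)) (J * (q / 4 + 1))).
      + apply Sum_le_mono.
        * unfold J. pose proof (Nat.mod_upper_bound M (q / 4 + 1) ltac:(lia)).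
          pose proof (Nat.div_mod M (q / 4 + 1) ltac:(lia)). lia.
        * intros k. unfold bucket_bound.
          pose proof (bucket_weight_ge0 M q (bucket q x (S k))).
          pose proof (bucket_weight_ge0 M q (2 * q - 1 - bucket q x (S k))). lra.
      + apply Sum_block_le. intros a. apply (bucket_bound_block M q p); auto. }
  (* Despite the integer division, [4 * (q / 4 + 1) >= q]. *)
  assert (HJ : INR J <= 4 * INR M / INR q + 1).
  { unfold J. rewrite plus_INR. apply Rplus_le_compat_r.
    apply Rmult_le_reg_r with (INR q); [lra|].
    replace (4 * INR M / INR q * INR q) with (INR 4 * INR M) by (simpl; field; lra).
    rewrite <- !mult_INR. apply le_INR.
    pose proof (Nat.Div0.mul_div_le M (q / 4 + 1)).
    pose proof (Nat.mod_upper_bound q 4 ltac:(lia)).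
    pose proof (Nat.div_mod q 4 ltac:(lia)). nia. }
  assert (HL1 : 1 <= L) by (unfold L; lra).
  assert (HS : 0 <= (Sum (fun n => sin (quad_phase x c n)) M) ^ 2) by apply pow2_ge_0.
  apply Rle_trans with (INR M + 2 * ((4 * INR M / INR q + 1) * (2 * (INR M + 2 * INR q * L)))).
  { rewrite Rplus_comm in E.
    assert (INR J * (2 * (INR M + 2 * INR q * L))
            <= (4 * INR M / INR q + 1) * (2 * (INR M + 2 * INR q * L))).
    { apply Rmult_le_compat_r; [nra|exact HJ]. }
    lra. }
  set (z := INR M ^ 2 / INR q).
  assert (Hz : 0 <= z) by (apply Rmult_le_pos; [apply pow2_ge_0|left; apply Rinv_0_lt_compat; lra]).
  replace (INR M + 2 * ((4 * INR M / INR q + 1) * (2 * (INR M + 2 * INR q * L))))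
    with (5 * INR M + 16 * z + 32 * (INR M * L) + 8 * (INR q * L)) by (unfold z; field; lra).
  nra.
Qed.

(** * Increments of the partial sums *)

(** Summation by parts against the weights [1/n^2]: the boundary terms cost [b/N] and [b/M], and the
    weight differences sum to at most [2b/N]. *)
Lemma abel_tail_bound (c : nat -> R) (b : R) (N M : nat) :
  (1 <= N)%nat -> (N <= M)%nat -> 0 <= b ->
  (forall k, (N <= k)%nat -> Rabs (Sum c k) <= b * INR k) ->
  Rabs (Sum (fun n => c n / INR (S n) ^ 2) M - Sum (fun n => c n / INR (S n) ^ 2) N) <= 4 * b / INR N.
Proof.
  intros HN HM Hb HA. set (W := Sum (fun n => c n / INR (S n) ^ 2)).
  assert (PN : 0 < INR N) by (apply lt_0_INR; lia).
  assert (boundary : forall k, (N <= k)%nat -> Rabs (Sum c k / INR k ^ 2) <= b / INR k).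
  { intros k Hk. assert (0 < INR k) by (apply lt_0_INR; lia).
    unfold Rdiv. rewrite Rabs_mult, (Rabs_pos_eq (/ INR k ^ 2))
      by (left; apply Rinv_0_lt_compat, pow_lt; lra).
    replace (b * / INR k) with (b * INR k * / INR k ^ 2) by (field; lra).
    apply Rmult_le_compat_r; [left; apply Rinv_0_lt_compat, pow_lt; lra|auto]. }
  (* Subtracting the boundary term at [M] leaves a quantity that grows by
     [Sum c M (1/M^2 - 1/(M+1)^2)] at each step, at most [2b (1/M - 1/(M+1))], which telescopes. *)
  assert (main : Rabs (W M - W N - Sum c M / INR M ^ 2) <= b / INR N + 2 * b * (/ INR N - / INR M)).
  { induction HM as [|M HM IH].
    - replace (W N - W N - Sum c N / INR N ^ 2) with (- (Sum c N / INR N ^ 2)) by ring.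
      rewrite Rabs_Ropp. specialize (boundary N ltac:(lia)). lra.
    - assert (PM : 0 < INR M) by (apply lt_0_INR; lia).
      replace (W (S M)) with (W M + c M / INR (S M) ^ 2) by reflexivity.
      cbn [Sum]. rewrite (S_INR M).
      replace (W M + c M / (INR M + 1) ^ 2 - W N - (Sum c M + c M) / (INR M + 1) ^ 2)
        with ((W M - W N - Sum c M / INR M ^ 2)
              + Sum c M * (/ INR M ^ 2 - / (INR M + 1) ^ 2)) by (field; lra).
      eapply Rle_trans; [apply Rabs_triang|].
      replace (b / INR N + 2 * b * (/ INR N - / (INR M + 1)))
        with ((b / INR N + 2 * b * (/ INR N - / INR M)) + 2 * b * (/ INR M - / (INR M + 1))) by ring.
      apply Rplus_le_compat; [exact IH|].
      assert (E : / INR M ^ 2 - / (INR M + 1) ^ 2 = (2 * INR M + 1) / (INR M ^ 2 * (INR M + 1) ^ 2))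
        by (field; lra).
      assert (0 <= / INR M ^ 2 - / (INR M + 1) ^ 2).
      { rewrite E. apply Rmult_le_pos; [lra|]. left. apply Rinv_0_lt_compat.
        apply Rmult_lt_0_compat; apply pow_lt; lra. }
      rewrite Rabs_mult, (Rabs_pos_eq (/ INR M ^ 2 - _)) by assumption.
      apply Rle_trans with (b * INR M * (/ INR M ^ 2 - / (INR M + 1) ^ 2)).
      + apply Rmult_le_compat_r; [assumption|apply HA; lia].
      + replace (2 * b * (/ INR M - / (INR M + 1)))
          with (b * INR M * (/ INR M ^ 2 - / (INR M + 1) ^ 2) + b / (INR M * (INR M + 1) ^ 2))
          by (field; lra).
        assert (0 <= b / (INR M * (INR M + 1) ^ 2)); [|lra].
        apply Rmult_le_pos; [lra|]. left. apply Rinv_0_lt_compat.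
        apply Rmult_lt_0_compat; [lra|apply pow_lt; lra]. }
  specialize (boundary M HM).
  assert (PM : 0 < INR M) by (apply lt_0_INR; lia).
  assert (b / INR M <= b / INR N).
  { apply Rmult_le_compat_l; [lra|]. apply Rinv_le_contravar; [lra|apply le_INR; lia]. }
  assert (0 <= b / INR M) by (apply Rmult_le_pos; [lra|left; apply Rinv_0_lt_compat; lra]).
  replace (W M - W N) with ((W M - W N - Sum c M / INR M ^ 2) + Sum c M / INR M ^ 2) by ring.
  eapply Rle_trans; [apply Rabs_triang|]. unfold Rdiv in *. lra.
Qed.

(** For [c = - PI/2] these are the partial sums of Riemann's function, the sum of
    [sin(2 PI n^2 x) / n^2]. *)
Definition riemann_sum (c : R) (M : nat) (x : R) : R :=
  Sum (fun n => cos (quad_phase x c n) / INR (S n) ^ 2) M.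

(** Differentiation cancels the weights and shifts the phase by a quarter period, so the derivative
    is again a sum to which Weyl's bound applies. *)
Lemma derivable_pt_lim_riemann_sum (c : R) (N : nat) (u : R) :
  derivable_pt_lim (riemann_sum c N) u
    (2 * PI * Sum (fun n => cos (quad_phase u (c + PI / 2) n)) N).
Proof.
  unfold riemann_sum. induction N as [|N IH]; cbn [Sum].
  - rewrite Rmult_0_r. apply derivable_pt_lim_const.
  - rewrite Rmult_plus_distr_l.
    apply (derivable_pt_lim_plus (riemann_sum c N) (fun x => cos (quad_phase x c N) / INR (S N) ^ 2));
      [exact IH|].
    assert (P : 0 < INR (S N)) by (apply lt_0_INR; lia).
    assert (H1 : derivable_pt_lim (fun x => quad_phase x c N) u (2 * PI * INR (S N) ^ 2)).
    { unfold quad_phase. intros eps He. exists (mkposreal 1 Rlt_0_1). intros h Hh _.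
      replace (_ - _) with 0 by (field; exact Hh). rewrite Rabs_R0. exact He. }
    pose proof (derivable_pt_lim_comp _ cos u _ _ H1 (derivable_pt_lim_cos _)) as H2.
    pose proof (derivable_pt_lim_scal _ (/ INR (S N) ^ 2) u _ H2) as H3.
    replace (2 * PI * cos (quad_phase u (c + PI / 2) N))
      with (/ INR (S N) ^ 2 * (- sin (quad_phase u c N) * (2 * PI * INR (S N) ^ 2))).
    + intros eps He. destruct (H3 eps He) as [d Hd]. exists d. intros h Hh Hhd.
      specialize (Hd h Hh Hhd). unfold mult_real_fct, comp in Hd.
      unfold Rdiv in *. rewrite !(Rmult_comm _ (/ INR (S N) ^ 2)). exact Hd.
    + unfold quad_phase.
      replace (2 * PI * INR (S N) ^ 2 * u + (c + PI / 2))
        with (PI / 2 + (2 * PI * INR (S N) ^ 2 * u + c)) by ring.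
      rewrite sin_cos. field. lra.
Qed.

(** The range of [q] is the one in which Weyl's bound has size [M T^(-1/2)], up to logarithms, for
    all [M >= r^(-1/2)]: the lower end controls [M^2/q], the upper end controls [q]. *)
Definition approximable (r T y : R) : Prop :=
  exists (p : Z) (q : nat),
    (0 < q)%nat /\ rel_prime p (Z.of_nat q) /\
    T / 2 <= INR q <= 2 / (r * T) /\ Rabs (y - IZR p / INR q) <= / (INR q * INR q).

Lemma ln_le_mono (x y : R) : 0 < x -> x <= y -> ln x <= ln y.
Proof.
  intros Hx H. destruct (Req_dec x y) as [->|]; [lra|]. left. apply ln_increasing; lra.
Qed.

Lemma approximable_weyl_bound (r T y c : R) (M : nat) :
  0 < r -> 1 <= T -> T * T * r <= 1 -> approximable r T y -> 1 <= r * INR M ^ 2 ->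
  Rabs (Sum (fun n => cos (quad_phase y c n)) M) <= sqrt (200 * (1 + ln (4 / r)) / T) * INR M.
Proof.
  intros Hr HT HTr (p & q & Hq & Hpq & [Hq1 Hq2] & Hy) HM.
  pose proof (weyl_bound M q p y c Hq Hpq Hy) as W.
  assert (PM : 0 <= INR M) by apply pos_INR.
  assert (Pq : 1 <= INR q) by (apply (le_INR 1); lia).
  (* The terms [M^2/q], [M] and [q] are at most [2z], [z] and [2z]; with the factor 40 of
     [weyl_bound] this gives the constant 200. *)
  set (z := INR M ^ 2 / T).
  assert (Hz : 0 <= z) by (apply Rmult_le_pos; [apply pow2_ge_0|left; apply Rinv_0_lt_compat; lra]).
  assert (MT : T <= INR M) by (apply Rnot_lt_le; intro; simpl in *; nra).
  assert (H1 : INR M ^ 2 / INR q <= 2 * z).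
  { unfold z. apply Rmult_le_reg_r with (INR q * T); [nra|]. field_simplify; [|lra|lra].
    pose proof (pow2_ge_0 (INR M)). nra. }
  assert (H2 : INR M <= z).
  { unfold z. apply Rmult_le_reg_r with T; [lra|]. field_simplify; [|lra]. simpl. nra. }
  assert (H3 : INR q <= 2 * z).
  { eapply Rle_trans; [exact Hq2|]. unfold z.
    apply Rmult_le_reg_r with (r * T); [nra|]. field_simplify; [|lra|split; lra].
    nra. }
  assert (HL0 : 0 <= ln (2 * INR q)) by (rewrite <- ln_1; apply ln_le_mono; lra).
  assert (HL : ln (2 * INR q) <= ln (4 / r)).
  { apply ln_le_mono; [lra|].
    apply Rle_trans with (2 * (2 / (r * T))); [lra|].
    apply Rmult_le_reg_r with (r * T); [nra|]. field_simplify; [nra|lra|split; lra]. }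
  apply Rsqr_incr_0_var;
    [|apply Rmult_le_pos; [apply sqrt_pos|exact PM]].
  rewrite <- Rsqr_abs, Rsqr_mult, Rsqr_sqrt;
    [|apply Rmult_le_pos; [nra|left; apply Rinv_0_lt_compat; lra]].
  rewrite !Rsqr_pow2. eapply Rle_trans; [exact W|].
  replace (200 * (1 + ln (4 / r)) / T * INR M ^ 2) with (40 * (1 + ln (4 / r)) * (5 * z))
    by (unfold z; field; lra).
  apply Rmult_le_compat; lra || nra.
Qed.

(** The bound does not depend on [M], so it survives the limit. Approximability is needed on the
    whole interval because the mean value point is not known. *)
Lemma riemann_sum_diff (c r T x x' : R) :
  0 < r <= 1 -> 1 <= T -> T * T * r <= 1 -> x <= x' <= x + r ->
  (forall y, x <= y <= x' -> approximable r T y) ->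
  exists N : nat, forall M : nat, (N <= M)%nat ->
  Rabs (riemann_sum c M x' - riemann_sum c M x) <= 24 * sqrt (200 * (1 + ln (4 / r)) / T) * sqrt r.
Proof.
  intros [Hr Hr1] HT HTr Hx Happ.
  set (b := sqrt (200 * (1 + ln (4 / r)) / T)).
  assert (Hb : 0 <= b) by apply sqrt_pos.
  set (s := sqrt r). assert (Hs : 0 < s) by (apply sqrt_lt_R0; lra).
  assert (Hss : s * s = r) by (apply sqrt_sqrt; lra).
  assert (Hs1 : s <= 1) by nra.
  (* The cutoff lies between [1/s] and [2/s] with [s = r^(1/2)]: Weyl's bound holds from [N] on,
     while [N r] is still at most [2s]. *)
  set (N := S (nfloor (/ s))).
  assert (Pis : 0 < / s) by (apply Rinv_0_lt_compat; lra).
  pose proof (nfloor_bounds (/ s) ltac:(lra)) as F.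
  assert (HN : INR N = INR (nfloor (/ s)) + 1) by (unfold N; rewrite S_INR; lra).
  assert (Hi : s * / s = 1) by (field; lra).
  assert (N1 : 1 <= s * INR N) by nra.
  assert (N2 : s * INR N <= 2) by nra.
  assert (HW : forall y c', x <= y <= x' -> forall k, (N <= k)%nat ->
     Rabs (Sum (fun n => cos (quad_phase y c' n)) k) <= b * INR k).
  { intros y c' Hy k Hk. apply approximable_weyl_bound; auto.
    apply le_INR in Hk. assert (1 <= s * INR k) by nra. rewrite <- Hss. simpl. nra. }
  exists N. intros M HM.
  assert (tail : forall y, x <= y <= x' ->
     Rabs (riemann_sum c M y - riemann_sum c N y) <= 4 * b * s).
  { intros y Hy. eapply Rle_trans.
    - apply (abel_tail_bound (fun n => cos (quad_phase y c n)) b N M); auto; unfold N; lia.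
    - apply Rmult_le_compat_l; [lra|].
      apply Rmult_le_reg_r with (INR N); [nra|]. field_simplify; nra. }
  (* The derivative is at most [8 b N] and the interval has length at most [s^2], whence [16 b s].
     The two tails add [4 b s] each, for a total of 24. *)
  assert (low : Rabs (riemann_sum c N x' - riemann_sum c N x) <= 16 * b * s).
  { destruct (Req_dec x x') as [<-|Hne].
    - rewrite Rminus_diag, Rabs_R0. nra.
    - destruct (MVT_cor2 (riemann_sum c N) _ x x' ltac:(lra)
        (fun u _ => derivable_pt_lim_riemann_sum c N u)) as (u & -> & Hu).
      specialize (HW u (c + PI / 2) ltac:(lra) N (le_n _)).
      rewrite !Rabs_mult, (Rabs_pos_eq 2), (Rabs_pos_eq PI), (Rabs_pos_eq (x' - x));
        try lra; [|pose proof PI_RGT_0; lra].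
      pose proof PI_4. pose proof PI_RGT_0.
      set (V := Rabs _) in *. assert (0 <= V) by apply Rabs_pos.
      apply Rle_trans with (2 * 4 * (b * INR N) * (s * s)).
      + apply Rmult_le_compat; [nra|lra|nra|lra].
      + replace (2 * 4 * (b * INR N) * (s * s)) with (8 * b * s * (s * INR N)) by ring.
        assert (0 <= b * s) by nra. nra. }
  pose proof (tail x ltac:(lra)) as T1. pose proof (tail x' ltac:(lra)) as T2.
  replace (riemann_sum c M x' - riemann_sum c M x)
    with ((riemann_sum c M x' - riemann_sum c N x') + (riemann_sum c N x' - riemann_sum c N x)
          - (riemann_sum c M x - riemann_sum c N x)) by ring.
  eapply Rle_trans; [apply Rabs_triang|]. rewrite Rabs_Ropp.
  pose proof (Rabs_triang (riemann_sum c M x' - riemann_sum c N x') (riemann_sum c N x' - riemann_sum c N x)).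
  lra.
Qed.

(** * Increments of phi *)

Lemma riemann_sum_cv (c x : R) : exists l, Un_cv (fun M => riemann_sum c M x) l.
Proof.
  assert (Cauchy_crit (fun M => riemann_sum c M x)) as H.
  2: { destruct (R_complete _ H) as [l Hl]. exists l. exact Hl. }
  assert (step : forall N M, (1 <= N)%nat -> (N <= M)%nat ->
     Rabs (riemann_sum c M x - riemann_sum c N x) <= 4 * 1 / INR N).
  { intros N M HN HM. apply (abel_tail_bound (fun n => cos (quad_phase x c n))); auto; [lra|].
    intros k _. rewrite Rmult_1_l. apply cos_sum_trivial_bound. }
  intros eps He.
  set (N := S (nfloor (8 / eps))).
  assert (P : 0 < 8 / eps) by (apply Rdiv_lt_0_compat; lra).
  pose proof (nfloor_bounds (8 / eps) ltac:(lra)) as F.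
  assert (HN : INR N = INR (nfloor (8 / eps)) + 1) by (unfold N; rewrite S_INR; lra).
  assert (small : 4 * 1 / INR N < eps / 2).
  { apply Rmult_lt_reg_r with (INR N); [lra|].
    replace (4 * 1 / INR N * INR N) with (8 / eps * (eps / 2)) by (field; lra).
    rewrite (Rmult_comm _ (INR N)). apply Rmult_lt_compat_r; lra. }
  exists N. intros n m Hn Hm. unfold Rdist.
  pose proof (step N n ltac:(unfold N; lia) ltac:(lia)).
  pose proof (step N m ltac:(unfold N; lia) ltac:(lia)).
  replace (riemann_sum c n x - riemann_sum c m x)
    with ((riemann_sum c n x - riemann_sum c N x) + - (riemann_sum c m x - riemann_sum c N x)) by ring.
  eapply Rle_lt_trans; [apply Rabs_triang|]. rewrite Rabs_Ropp. lra.
Qed.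

Lemma seq_lim_unique (u : nat -> R) (l : R) : Un_cv u l -> seq_lim u = l.
Proof.
  intros H. apply UL_sequence with u; [|exact H].
  unfold seq_lim. apply epsilon_spec. exists l. exact H.
Qed.

(** The frequencies [k] and [-k] contribute equally, which turns [1/(4 PI^2)] into [1/(2 PI^2)]. The
    sum of [1/n^2] is written as the Riemann sum at 0, and the term [k = 0] has no real part. *)
Lemma fst_phi_partial_sum (t : R) (M : nat) :
  sum_f_R0 (fun n => fst (phi_block n t)) M
  = / (2 * PI ^ 2) * (riemann_sum 0 M 0 - riemann_sum 0 M (2 * PI * t)).
Proof.
  rewrite sum_f_R0_Sum, Sum_recl. unfold riemann_sum. pose proof PI_RGT_0.
  induction M as [|M IH]; cbn [Sum].
  - unfold phi_block; simpl. ring.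
  - rewrite <- Rplus_assoc, IH.
    assert (0 < INR (S M)) by (apply lt_0_INR; lia).
    assert (E : fst (phi_block (S M) t)
      = / (2 * PI ^ 2) * ((1 - cos (quad_phase (2 * PI * t) 0 M)) / INR (S M) ^ 2)).
    { unfold phi_block, phi_term.
      replace (Z.eqb (Z.of_nat (S M)) 0) with false by (symmetry; apply Z.eqb_neq; lia).
      replace (Z.eqb (- Z.of_nat (S M)) 0) with false by (symmetry; apply Z.eqb_neq; lia).
      cbn [Nat.eqb fst]. rewrite opp_IZR, <- INR_IZR_INZ. unfold quad_phase.
      replace (4 * PI ^ 2 * (- INR (S M)) ^ 2 * t) with (4 * PI ^ 2 * INR (S M) ^ 2 * t) by ring.
      replace (2 * PI * INR (S M) ^ 2 * (2 * PI * t) + 0) with (4 * PI ^ 2 * INR (S M) ^ 2 * t) by ring.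
      field. lra. }
    rewrite E. replace (cos (quad_phase 0 0 M)) with 1.
    + field. lra.
    + unfold quad_phase. rewrite Rmult_0_r, Rplus_0_r, cos_0. reflexivity.
Qed.

(** The summand [t] is the term [k = 0]; the phase [- PI/2] turns cosines into sines. *)
Lemma snd_phi_partial_sum (t : R) (M : nat) :
  sum_f_R0 (fun n => snd (phi_block n t)) M
  = t + / (2 * PI ^ 2) * riemann_sum (- (PI / 2)) M (2 * PI * t).
Proof.
  rewrite sum_f_R0_Sum, Sum_recl. unfold riemann_sum. pose proof PI_RGT_0.
  induction M as [|M IH]; cbn [Sum].
  - unfold phi_block; simpl. ring.
  - rewrite <- Rplus_assoc, IH.
    assert (0 < INR (S M)) by (apply lt_0_INR; lia).
    assert (E : snd (phi_block (S M) t)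
      = / (2 * PI ^ 2) * (cos (quad_phase (2 * PI * t) (- (PI / 2)) M) / INR (S M) ^ 2)).
    { unfold phi_block, phi_term.
      replace (Z.eqb (Z.of_nat (S M)) 0) with false by (symmetry; apply Z.eqb_neq; lia).
      replace (Z.eqb (- Z.of_nat (S M)) 0) with false by (symmetry; apply Z.eqb_neq; lia).
      cbn [Nat.eqb snd]. rewrite opp_IZR, <- INR_IZR_INZ. unfold quad_phase.
      replace (4 * PI ^ 2 * (- INR (S M)) ^ 2 * t) with (4 * PI ^ 2 * INR (S M) ^ 2 * t) by ring.
      replace (2 * PI * INR (S M) ^ 2 * (2 * PI * t) + - (PI / 2))
        with (- (PI / 2 - 4 * PI ^ 2 * INR (S M) ^ 2 * t)) by field.
      rewrite cos_neg, cos_shift. field. lra. }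
    rewrite E. ring.
Qed.

Lemma Un_cv_const (a : R) : Un_cv (fun _ => a) a.
Proof. intros e He. exists O. intros. unfold Rdist. rewrite Rminus_diag, Rabs_R0. exact He. Qed.

Lemma Un_cv_ext (u v : nat -> R) (l : R) : (forall n, u n = v n) -> Un_cv u l -> Un_cv v l.
Proof. intros E H e He. destruct (H e He) as [N HN]. exists N. intros. rewrite <- E. auto. Qed.

Lemma fst_phi_cv (t : R) :
  Un_cv (fun M => / (2 * PI ^ 2) * (riemann_sum 0 M 0 - riemann_sum 0 M (2 * PI * t))) (fst (phi t)).
Proof.
  destruct (riemann_sum_cv 0 0) as [a Ha]. destruct (riemann_sum_cv 0 (2 * PI * t)) as [b Hb].
  assert (H : Un_cv (fun M => / (2 * PI ^ 2) * (riemann_sum 0 M 0 - riemann_sum 0 M (2 * PI * t)))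
            (/ (2 * PI ^ 2) * (a - b))).
  { apply CV_mult; [apply Un_cv_const|]. apply CV_minus; assumption. }
  unfold phi. cbn [fst]. erewrite seq_lim_unique; [exact H|].
  eapply Un_cv_ext; [|exact H]. intros n. symmetry. apply fst_phi_partial_sum.
Qed.

Lemma snd_phi_cv (t : R) :
  Un_cv (fun M => t + / (2 * PI ^ 2) * riemann_sum (- (PI / 2)) M (2 * PI * t)) (snd (phi t)).
Proof.
  destruct (riemann_sum_cv (- (PI / 2)) (2 * PI * t)) as [b Hb].
  assert (H : Un_cv (fun M => t + / (2 * PI ^ 2) * riemann_sum (- (PI / 2)) M (2 * PI * t))
            (t + / (2 * PI ^ 2) * b)).
  { apply CV_plus; [apply Un_cv_const|]. apply CV_mult; [apply Un_cv_const|assumption]. }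
  unfold phi. cbn [snd]. erewrite seq_lim_unique; [exact H|].
  eapply Un_cv_ext; [|exact H]. intros n. symmetry. apply snd_phi_partial_sum.
Qed.

Lemma Rabs_limit_le (u : nat -> R) (l B : R) (N : nat) :
  Un_cv u l -> (forall M, (N <= M)%nat -> Rabs (u M) <= B) -> Rabs l <= B.
Proof.
  intros H HB. apply Rnot_lt_le. intros Hlt.
  destruct (H (Rabs l - B) ltac:(lra)) as [N1 HN].
  specialize (HN (max N N1) ltac:(lia)). specialize (HB (max N N1) ltac:(lia)).
  unfold Rdist in HN. rewrite Rabs_minus_sym in HN.
  pose proof (Rabs_triang_inv l (u (max N N1))). lra.
Qed.

Lemma cdist_le_components (z w : Defs.C) : cdist z w <= Rabs (fst z - fst w) + Rabs (snd z - snd w).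
Proof.
  unfold cdist, cnorm. cbn [fst snd].
  set (a := fst z - fst w). set (b := snd z - snd w).
  pose proof (Rabs_pos a). pose proof (Rabs_pos b).
  apply Rsqr_incr_0_var; [|lra]. rewrite Rsqr_sqrt by nra.
  pose proof (Rsqr_abs a). pose proof (Rsqr_abs b). unfold Rsqr in *. nra.
Qed.

Lemma cdist_sym (z w : Defs.C) : cdist z w = cdist w z.
Proof. unfold cdist, cnorm. cbn [fst snd]. f_equal. ring. Qed.

Lemma phi_diff_le_sqrt (r T t t' : R) :
  0 < r <= 1 -> 1 <= T -> T * T * r <= 1 ->
  2 * PI * t <= 2 * PI * t' <= 2 * PI * t + r ->
  (forall y, 2 * PI * t <= y <= 2 * PI * t' -> approximable r T y) ->
  cdist (phi t') (phi t) <= 5 * (sqrt (200 * (1 + ln (4 / r)) / T) * sqrt r).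
Proof.
  intros Hr HT HTr Ht Happ.
  assert (HL : 0 <= ln (4 / r)).
  { rewrite <- ln_1. apply ln_le_mono; [lra|].
    apply Rmult_le_reg_r with r; [lra|]. field_simplify; lra. }
  pose proof PI2_3_2 as HPI.
  assert (HPI2 : 9 <= PI ^ 2) by nra.
  set (b := sqrt (200 * (1 + ln (4 / r)) / T) * sqrt r).
  (* This absorbs the increment of the linear term of [phi]; it holds because [T r <= 1]. *)
  assert (Hb : r <= b).
  { unfold b. rewrite <- sqrt_mult_alt.
    2: { apply Rmult_le_pos; [lra|left; apply Rinv_0_lt_compat; lra]. }
    rewrite <- (sqrt_square r) at 1 by lra. apply sqrt_le_1_alt.
    apply Rmult_le_compat_r; [lra|].
    apply Rmult_le_reg_r with T; [lra|]. field_simplify; [|lra]. nra. }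
  assert (comp : forall c, exists N, forall M, (N <= M)%nat ->
     Rabs (/ (2 * PI ^ 2) * (riemann_sum c M (2 * PI * t') - riemann_sum c M (2 * PI * t))) <= 2 * b).
  { intros c. destruct (riemann_sum_diff c r T (2 * PI * t) (2 * PI * t')) as [N HN]; auto.
    exists N. intros M HM. specialize (HN M HM).
    rewrite Rabs_mult, Rabs_pos_eq by (left; apply Rinv_0_lt_compat; lra).
    apply Rmult_le_reg_l with (2 * PI ^ 2); [lra|]. rewrite <- Rmult_assoc, Rinv_r by lra.
    replace (24 * sqrt (200 * (1 + ln (4 / r)) / T) * sqrt r) with (24 * b) in HN by (unfold b; ring).
    set (V := Rabs _) in *. nra. }
  assert (H1 : Rabs (fst (phi t') - fst (phi t)) <= 2 * b).
  { destruct (comp 0) as [N HN].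
    eapply Rabs_limit_le with (N := N); [apply CV_minus; apply fst_phi_cv|].
    intros M HM. cbv beta. rewrite <- Rabs_Ropp.
    match goal with |- Rabs ?a <= _ => replace a with
      (/ (2 * PI ^ 2) * (riemann_sum 0 M (2 * PI * t') - riemann_sum 0 M (2 * PI * t))) by ring end.
    auto. }
  assert (H2 : Rabs (snd (phi t') - snd (phi t)) <= 3 * b).
  { destruct (comp (- (PI / 2))) as [N HN].
    eapply Rabs_limit_le with (N := N); [apply CV_minus; apply snd_phi_cv|].
    intros M HM. cbv beta. specialize (HN M HM).
    match goal with |- Rabs ?a <= _ => replace a with
      ((t' - t) + / (2 * PI ^ 2) * (riemann_sum (- (PI / 2)) M (2 * PI * t')
         - riemann_sum (- (PI / 2)) M (2 * PI * t))) by ring end.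
    eapply Rle_trans; [apply Rabs_triang|].
    assert (Rabs (t' - t) <= b); [|lra]. rewrite Rabs_pos_eq; nra. }
  pose proof (cdist_le_components (phi t') (phi t)). lra.
Qed.

Lemma Rpower_pos (x a : R) : 0 < Rpower x a.
Proof. apply exp_pos. Qed.

(** Both parts come from [exp y >= 1 + y]: with [y = ln 4] it gives [1 + ln 4 <= 4], with
    [y = - eps ln r] it bounds [- ln r]. *)
Lemma log_factor_le (eps r : R) : 0 < eps -> 0 < r <= 1 ->
  1 + ln (4 / r) <= (4 + / eps) * Rpower r (- eps).
Proof.
  intros He Hr. unfold Rdiv. rewrite ln_mult, ln_Rinv by (try apply Rinv_0_lt_compat; lra).
  pose proof (exp_ineq1_le (ln 4)) as E4. rewrite exp_ln in E4 by lra.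
  unfold Rpower. pose proof (exp_ineq1_le (- eps * ln r)) as E.
  assert (ln r <= 0) by (rewrite <- ln_1; apply ln_le_mono; lra).
  set (X := exp (- eps * ln r)) in *.
  assert (1 <= X) by nra.
  assert (- ln r <= / eps * X).
  { apply Rmult_le_reg_l with eps; [lra|]. rewrite <- Rmult_assoc, Rinv_r by lra. lra. }
  nra.
Qed.

Lemma phi_diff_le_Rpower (eps : R) : 0 < eps ->
  exists K, 0 < K /\ forall r T t t',
  0 < r <= 1 -> 1 <= T -> T * T * r <= 1 ->
  Rabs (2 * PI * t' - 2 * PI * t) <= r ->
  (forall y, Rabs (y - 2 * PI * t) <= r -> approximable r T y) ->
  cdist (phi t') (phi t) <= K * (Rpower r (1 / 2 - eps) * Rpower T (- (1 / 2))).
Proof.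
  intros He. set (K := sqrt (200 * (4 + / (2 * eps)))).
  assert (0 < / (2 * eps)) by (apply Rinv_0_lt_compat; lra).
  assert (HK : 0 < K) by (apply sqrt_lt_R0; lra).
  exists (5 * K). split; [lra|]. intros r T t t' Hr HT HTr Ht Happ.
  assert (Hmain : cdist (phi t') (phi t) <= 5 * (sqrt (200 * (1 + ln (4 / r)) / T) * sqrt r)).
  { assert (- r <= 2 * PI * t' - 2 * PI * t <= r)
      by (unfold Rabs in Ht; destruct (Rcase_abs _); lra).
    destruct (Rle_dec t t') as [Htt|Htt].
    - apply phi_diff_le_sqrt; auto; [pose proof PI_RGT_0; nra|].
      intros y Hy. apply Happ, Rabs_le. lra.
    - rewrite cdist_sym. apply phi_diff_le_sqrt; auto; [pose proof PI_RGT_0; nra|].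
      intros y Hy. apply Happ, Rabs_le. lra. }
  eapply Rle_trans; [exact Hmain|].
  rewrite Rmult_assoc. apply Rmult_le_compat_l; [lra|].
  (* The exponent is [2 * eps] since the logarithm stands under a square root. *)
  pose proof (log_factor_le (2 * eps) r ltac:(lra) Hr) as HL.
  assert (HL0 : 0 <= 1 + ln (4 / r)).
  { assert (0 <= ln (4 / r)); [|lra]. rewrite <- ln_1. apply ln_le_mono; [lra|].
    apply Rmult_le_reg_r with r; [lra|]. field_simplify; lra. }
  assert (IT : 0 < / T) by (apply Rinv_0_lt_compat; lra).
  rewrite <- sqrt_mult_alt by (apply Rmult_le_pos; lra).
  set (Y := Rpower r (1 / 2 - eps) * Rpower T (- (1 / 2))).
  assert (HY : 0 < Y) by (apply Rmult_lt_0_compat; apply Rpower_pos).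
  rewrite <- (sqrt_square Y) by lra. unfold K. rewrite <- sqrt_mult_alt by lra.
  apply sqrt_le_1_alt.
  replace (Y * Y) with (Rpower r (- (2 * eps)) * r * / T).
  - unfold Rdiv. replace (200 * (1 + ln (4 * / r)) * / T * r) with (200 * (1 + ln (4 / r)) * (r * / T))
      by (unfold Rdiv; ring).
    replace (200 * (4 + / (2 * eps)) * (Rpower r (- (2 * eps)) * r * / T))
      with (200 * ((4 + / (2 * eps)) * Rpower r (- (2 * eps))) * (r * / T)) by ring.
    apply Rmult_le_compat_r; [nra|]. lra.
  - unfold Y. replace (Rpower r (1 / 2 - eps) * Rpower T (- (1 / 2)) *
      (Rpower r (1 / 2 - eps) * Rpower T (- (1 / 2)))) with
      ((Rpower r (1 / 2 - eps) * Rpower r (1 / 2 - eps)) * (Rpower T (- (1 / 2)) * Rpower T (- (1 / 2)))) by ring.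
    rewrite <- !Rpower_plus.
    replace (- (1 / 2) + - (1 / 2)) with (- (1)) by field.
    replace (1 / 2 - eps + (1 / 2 - eps)) with (- (2 * eps) + 1) by field.
    rewrite (Rpower_Ropp T), (Rpower_1 T), Rpower_plus, (Rpower_1 r) by lra. ring.
Qed.

(** * Rational approximation *)

(* Induction along the Farey sequences: consecutive fractions have determinant 1, and
   are separated further only by their mediant. *)
Lemma farey_neighbours (y : R) (n : nat) : (1 <= n)%nat ->
  exists (P P' : Z) (Q Q' : nat),
    (0 < Q <= n)%nat /\ (0 < Q' <= n)%nat /\ (n + 1 <= Q + Q')%nat /\
    (P' * Z.of_nat Q - P * Z.of_nat Q' = 1)%Z /\
    IZR P <= y * INR Q /\ y * INR Q' <= IZR P'.
Proof.
  induction n as [|n IH]; intros Hn; [lia|]. destruct n as [|n].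
  - exists (Int_part y), (Int_part y + 1)%Z, 1%nat, 1%nat. rewrite plus_IZR.
    pose proof (base_Int_part y). simpl INR. repeat split; try lia; lra.
  - destruct IH as (P & P' & Q & Q' & H1 & H2 & H3 & H4 & H5 & H6); [lia|].
    destruct (le_lt_dec (S (S n) + 1) (Q + Q')) as [Hle|Hlt].
    + exists P, P', Q, Q'. repeat split; try lia; assumption.
    + destruct (Rle_dec (IZR (P + P')) (y * INR (Q + Q'))) as [Hy|Hy].
      * exists (P + P')%Z, P', (Q + Q')%nat, Q'. repeat split; try lia; assumption.
      * exists P, (P + P')%Z, Q, (Q + Q')%nat. repeat split; try lia; lra.
Qed.

(** Of the two Farey neighbours of order [nfloor R0], the one on the same side of the mediant as [y]
    is chosen. Determinant 1 gives both its coprimality and the error bound, as the denominators add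
    up to at least [R0]. *)
Lemma dirichlet_coprime (y R0 : R) : 1 <= R0 ->
  exists (p : Z) (q : nat), (0 < q)%nat /\ rel_prime p (Z.of_nat q) /\
    INR q <= R0 /\ Rabs (y - IZR p / INR q) <= / (INR q * R0).
Proof.
  intros HR. pose proof (nfloor_bounds R0 ltac:(lra)) as F. set (n := nfloor R0) in *.
  assert (Hn : (1 <= n)%nat).
  { destruct n; [|lia]. simpl in F. lra. }
  destruct (farey_neighbours y n Hn) as (P & P' & Q & Q' & H1 & H2 & H3 & H4 & H5 & H6).
  assert (HQ : 0 < INR Q) by (apply lt_0_INR; lia).
  assert (HQ' : 0 < INR Q') by (apply lt_0_INR; lia).
  assert (E : IZR P' * INR Q - IZR P * INR Q' = 1).
  { rewrite !INR_IZR_INZ, <- !mult_IZR, <- minus_IZR, H4. reflexivity. }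
  assert (HS : R0 <= INR Q + INR Q').
  { rewrite <- plus_INR. apply le_INR in H3. rewrite plus_INR in H3. simpl in H3. lra. }
  assert (Qn : INR Q <= INR n) by (apply le_INR; lia).
  assert (Qn' : INR Q' <= INR n) by (apply le_INR; lia).
  assert (bound : forall z Q0, 0 < Q0 -> Rabs (z * (INR Q + INR Q')) <= 1 -> Rabs (z / Q0) <= / (Q0 * R0)).
  { intros z Q0 HQ0 Hz. rewrite Rabs_mult, (Rabs_pos_eq (INR Q + INR Q')) in Hz by lra.
    unfold Rdiv. rewrite Rabs_mult, Rabs_inv, (Rabs_pos_eq Q0), Rinv_mult, Rmult_comm by lra.
    apply Rmult_le_compat_l; [left; apply Rinv_0_lt_compat; lra|].
    apply Rmult_le_reg_r with R0; [lra|]. rewrite Rinv_l by lra. pose proof (Rabs_pos z). nra. }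
  destruct (Rle_dec (y * (INR Q + INR Q')) (IZR P + IZR P')) as [Hy|Hy].
  - exists P, Q. split; [lia|]. split; [|split; [lra|]].
    + apply bezout_rel_prime. apply Bezout_intro with (- Z.of_nat Q')%Z P'. lia.
    + replace (y - IZR P / INR Q) with ((y * INR Q - IZR P) / INR Q) by (field; lra).
      apply bound; [lra|]. apply Rabs_le. nra.
  - exists P', Q'. split; [lia|]. split; [|split; [lra|]].
    + apply bezout_rel_prime. apply Bezout_intro with (Z.of_nat Q) (- P)%Z. lia.
    + replace (y - IZR P' / INR Q') with ((y * INR Q' - IZR P') / INR Q') by (field; lra).
      apply bound; [lra|]. apply Rabs_le. nra.
Qed.

Definition irrational (x : R) : Prop :=
  forall (p : Z) (q : nat), (0 < q)%nat -> x <> IZR p / INR q.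

Lemma irrational_dist (x : R) (q : nat) : irrational x -> (0 < q)%nat ->
  exists d, 0 < d /\ forall p : Z, d <= Rabs (x - IZR p / INR q).
Proof.
  intros Hx Hq. assert (Hq' : 0 < INR q) by (apply lt_0_INR; lia).
  pose proof (frac_part_bounds (INR q * x)) as F.
  set (k := Int_part (INR q * x)). set (f := frac_part (INR q * x)) in *.
  assert (Ef : INR q * x = IZR k + f) by (unfold f, frac_part, k; ring).
  assert (Hf : f <> 0).
  { intros E. apply (Hx k q Hq). apply Rmult_eq_reg_l with (INR q); [|lra].
    rewrite Ef, E. field. lra. }
  exists (Rmin f (1 - f) / INR q). split.
  - apply Rdiv_lt_0_compat; [|lra]. apply Rmin_pos; lra.
  - intros p. replace (x - IZR p / INR q) with ((INR q * x - IZR p) / INR q) by (field; lra).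
    unfold Rdiv. rewrite Rabs_mult, (Rabs_pos_eq (/ INR q)) by (left; apply Rinv_0_lt_compat; lra).
    apply Rmult_le_compat_r; [left; apply Rinv_0_lt_compat; lra|]. rewrite Ef.
    pose proof (Rmin_l f (1 - f)). pose proof (Rmin_r f (1 - f)).
    destruct (Z.le_gt_cases p k) as [Hp|Hp].
    + apply IZR_le in Hp. rewrite Rabs_pos_eq; lra.
    + assert (Hp' : (k + 1 <= p)%Z) by lia. apply IZR_le in Hp'. rewrite plus_IZR in Hp'.
      rewrite Rabs_left1; lra.
Qed.

Lemma irrational_dist_below (x : R) (Q0 : nat) : irrational x ->
  exists d, 0 < d /\ forall (p : Z) (q : nat), (0 < q < Q0)%nat -> d <= Rabs (x - IZR p / INR q).
Proof.
  intros Hx. induction Q0 as [|Q0 (d & Hd & H)]; [exists 1; split; [lra|intros; lia]|].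
  destruct (Nat.eq_dec Q0 0) as [->|Hne].
  - exists 1; split; [lra|intros; lia].
  - destruct (irrational_dist x Q0 Hx ltac:(lia)) as (d' & Hd' & H').
    exists (Rmin d d'). split; [apply Rmin_pos; lra|]. intros p q Hq.
    pose proof (Rmin_l d d'). pose proof (Rmin_r d d').
    destruct (Nat.eq_dec q Q0) as [->|]; [specialize (H' p); lra|].
    specialize (H p q ltac:(lia)). lra.
Qed.

(** Dirichlet's theorem with bound [2/(r T)] supplies everything except the lower bound on the
    denominator, so only fractions with small denominators have to be excluded. *)
Lemma approximable_of_large_denominator (r T y : R) :
  0 < r -> 1 <= T -> T * T * r <= 1 ->
  (forall (p : Z) (q : nat), (0 < q)%nat -> rel_prime p (Z.of_nat q) ->
     Rabs (y - IZR p / INR q) <= r * T / (2 * INR q) -> T / 2 <= INR q) ->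
  approximable r T y.
Proof.
  intros Hr HT HTr H.
  assert (0 < r * T) by nra.
  assert (HR : 1 <= 2 / (r * T)).
  { apply Rmult_le_reg_r with (r * T); [lra|]. field_simplify; [nra|split; lra]. }
  destruct (dirichlet_coprime y (2 / (r * T)) HR) as (p & q & Hq & Hpq & HqR & Hy).
  assert (Hq' : 0 < INR q) by (apply lt_0_INR; lia).
  exists p, q. split; [exact Hq|]. split; [exact Hpq|]. split; [split; [|exact HqR]|].
  - apply (H p q Hq Hpq). eapply Rle_trans; [exact Hy|]. right. field. repeat split; lra.
  - eapply Rle_trans; [exact Hy|]. apply Rinv_le_contravar; nra.
Qed.

Lemma Rpower_le_1 (x a : R) : 0 < x <= 1 -> 0 <= a -> Rpower x a <= 1.
Proof.
  intros Hx Ha. unfold Rpower. rewrite <- exp_0.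
  assert (ln x <= 0) by (rewrite <- ln_1; apply ln_le_mono; lra).
  destruct (Req_dec (a * ln x) 0) as [->|]; [lra|]. left. apply exp_increasing. nra.
Qed.

(** A fraction [P/Q] with [Q < q/2] differs from [p/q], hence by at least [1/(qQ)]. Both cannot be
    as close to [y] as assumed, since [q^2 r <= 1]. *)
Lemma approximable_near_rational (tau : R) (p : Z) (q : nat) (y : R) :
  2 <= tau -> (0 < q)%nat -> rel_prime p (Z.of_nat q) ->
  Rabs (y - IZR p / INR q) <= Rpower (INR q) (- tau) ->
  approximable (Rpower (INR q) (- tau)) (INR q) y.
Proof.
  intros Ht Hq Hpq Hy.
  assert (Hq' : 1 <= INR q) by (apply (le_INR 1); lia).
  set (r := Rpower (INR q) (- tau)) in *.
  assert (Hr : 0 < r) by apply Rpower_pos.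
  assert (Hrq : INR q * INR q * r <= 1).
  { replace (INR q * INR q * r) with (Rpower (INR q) (2 - tau)).
    - rewrite <- (Rpower_O (INR q)) by lra. apply Rle_Rpower; lra.
    - unfold r. replace (2 - tau) with (1 + 1 + - tau) by ring.
      rewrite !Rpower_plus, !Rpower_1 by lra. ring. }
  apply approximable_of_large_denominator; auto.
  intros P Q HQ HPQ HyP. apply Rnot_lt_le. intros Hlt.
  assert (HQ' : 0 < INR Q) by (apply lt_0_INR; lia).
  assert (Hne : (p * Z.of_nat Q - P * Z.of_nat q <> 0)%Z).
  { intros E. assert (D : (Z.of_nat q | Z.of_nat Q)%Z).
    { apply Gauss with p; [exists P; lia|apply rel_prime_sym, Hpq]. }
    apply Z.divide_pos_le in D; [|lia]. assert (Hle : (q <= Q)%nat) by lia.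
    apply le_INR in Hle. lra. }
  assert (H1 : 1 <= Rabs (IZR p * INR Q - IZR P * INR q)).
  { rewrite !INR_IZR_INZ, <- !mult_IZR, <- minus_IZR, <- abs_IZR. apply IZR_le. lia. }
  replace (IZR p * INR Q - IZR P * INR q)
    with (INR q * INR Q * ((y - IZR P / INR Q) + - (y - IZR p / INR q))) in H1 by (field; lra).
  rewrite Rabs_mult, (Rabs_pos_eq (INR q * INR Q)) in H1 by nra.
  pose proof (Rabs_triang (y - IZR P / INR Q) (- (y - IZR p / INR q))) as Tri.
  rewrite Rabs_Ropp in Tri.
  assert (H2 : 1 <= INR q * INR Q * (r * INR q / (2 * INR Q) + r)).
  { eapply Rle_trans; [exact H1|]. apply Rmult_le_compat_l; [nra|lra]. }
  replace (INR q * INR Q * (r * INR q / (2 * INR Q) + r))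
    with (INR q * INR q * r / 2 + INR q * r * INR Q) in H2 by (field; lra).
  assert (0 < INR q * r) by nra. nra.
Qed.

(** With [T = r^(-1/tau)], a fraction of denominator [q < T/2] too close to [y] would lie within
    [r T / q] of [x]. For [q >= Q0] this contradicts the hypothesis because [r T^tau = 1]; smaller
    [q] stay at a fixed distance [d] from [x]. *)
Lemma approximable_of_badly_approximable (tau x : R) (Q0 : nat) :
  2 <= tau -> irrational x ->
  (forall (p : Z) (q : nat), (0 < q)%nat -> (Q0 <= q)%nat -> rel_prime p (Z.of_nat q) ->
     Rpower (INR q) (- tau) < Rabs (x - IZR p / INR q)) ->
  exists delta, 0 < delta <= 1 /\ forall r y, 0 < r < delta -> Rabs (y - x) <= r ->
    approximable r (Rpower r (- / tau)) y.
Proof.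
  intros Ht Hx Hbad. destruct (irrational_dist_below x Q0 Hx) as (d & Hd & Hsmall).
  (* Since [(r T)^2 <= r], the condition [r < d^2] gives [r T < d]. *)
  exists (Rmin 1 (d * d)). split; [split; [apply Rmin_pos; nra|apply Rmin_l]|].
  intros r y [Hr Hrd] Hy.
  assert (Hr1 : r < 1) by (eapply Rlt_le_trans; [exact Hrd|apply Rmin_l]).
  assert (Hr2 : r < d * d) by (eapply Rlt_le_trans; [exact Hrd|apply Rmin_r]).
  assert (It : 0 < / tau <= / 2).
  { split; [apply Rinv_0_lt_compat; lra|apply Rinv_le_contravar; lra]. }
  set (T := Rpower r (- / tau)).
  assert (HT : 1 <= T).
  { unfold T. rewrite Rpower_Ropp. rewrite <- Rinv_1. apply Rinv_le_contravar; [apply Rpower_pos|].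
    apply Rpower_le_1; lra. }
  assert (HTr : T * T * r <= 1).
  { rewrite <- (Rpower_1 r) at 1 by lra. unfold T. rewrite <- !Rpower_plus.
    apply Rpower_le_1; lra. }
  apply approximable_of_large_denominator; auto.
  intros p q Hq Hpq Hyp. apply Rnot_lt_le. intros Hlt.
  assert (Hq' : 1 <= INR q) by (apply (le_INR 1); lia).
  assert (HrT : r <= r * T / (2 * INR q)).
  { apply Rmult_le_reg_r with (2 * INR q); [lra|]. field_simplify; [nra|lra]. }
  assert (Hxp : Rabs (x - IZR p / INR q) <= r * T / INR q).
  { replace (x - IZR p / INR q) with ((y - IZR p / INR q) + - (y - x)) by ring.
    eapply Rle_trans; [apply Rabs_triang|]. rewrite Rabs_Ropp.
    replace (r * T / INR q) with (r * T / (2 * INR q) + r * T / (2 * INR q)) by (field; lra). lra. }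
  destruct (le_lt_dec Q0 q) as [HQ|HQ].
  - specialize (Hbad p q Hq HQ Hpq).
    assert (HrTT : r * Rpower T tau = 1).
    { unfold T. rewrite Rpower_mult. replace (- / tau * tau) with (- (1)) by (field; lra).
      rewrite Rpower_Ropp, Rpower_1 by lra. field. lra. }
    assert (E1 : Rpower T tau = T * Rpower T (tau - 1)).
    { rewrite <- (Rpower_1 T) at 2 by lra. rewrite <- Rpower_plus. f_equal. ring. }
    assert (E2 : Rpower (INR q) (tau - 1) <= Rpower T (tau - 1)) by (apply Rle_Rpower_l; lra).
    assert (E3 : Rpower (INR q) (- tau) = / (INR q * Rpower (INR q) (tau - 1))).
    { rewrite Rpower_Ropp. f_equal. rewrite <- (Rpower_1 (INR q)) at 2 by lra.
      rewrite <- Rpower_plus. f_equal. ring. }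
    rewrite E3 in Hbad. pose proof (Rpower_pos (INR q) (tau - 1)) as Pq.
    set (U := Rpower (INR q) (tau - 1)) in *.
    assert (H1 : / (INR q * U) < r * T / INR q) by lra.
    apply Rmult_lt_compat_r with (r := INR q * U) in H1; [|nra].
    rewrite Rinv_l in H1 by nra.
    replace (r * T / INR q * (INR q * U)) with (r * T * U) in H1 by (field; lra).
    rewrite E1 in HrTT. assert (0 < r * T) by nra. nra.
  - specialize (Hsmall p q ltac:(lia)).
    assert (H1 : r * T / INR q <= r * T).
    { assert (0 < r * T) by nra. apply Rmult_le_reg_r with (INR q); [lra|].
      replace (r * T / INR q * INR q) with (r * T) by (field; lra). nra. }
    assert (H2 : (r * T) * (r * T) <= r) by nra.
    assert (d <= r * T) by lra. nra.
Qed.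

(** For [alpha = 3/4] this makes every irrational point well approximable with [tau = 2]. The bound
    [2/d] in Dirichlet's theorem rules out denominators below [Q0]. *)
Lemma irrational_dirichlet (x : R) (Q0 : nat) : irrational x ->
  exists (p : Z) (q : nat), (0 < q)%nat /\ (Q0 <= q)%nat /\ rel_prime p (Z.of_nat q) /\
    Rabs (x - IZR p / INR q) <= Rpower (INR q) (- (2)).
Proof.
  intros Hx. destruct (irrational_dist_below x Q0 Hx) as (d & Hd & Hsmall).
  destruct (dirichlet_coprime x (Rmax 1 (2 / d))) as (p & q & Hq & Hpq & HqR & Hy); [apply Rmax_l|].
  assert (Hq' : 1 <= INR q) by (apply (le_INR 1); lia).
  pose proof (Rmax_l 1 (2 / d)) as M1. pose proof (Rmax_r 1 (2 / d)) as M2.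
  set (m := Rmax 1 (2 / d)) in *.
  exists p, q. split; [exact Hq|]. split; [|split; [exact Hpq|]].
  - destruct (le_lt_dec Q0 q) as [|HQ]; [assumption|]. exfalso.
    specialize (Hsmall p q ltac:(lia)).
    assert (Hm : d * m >= 2).
    { replace 2 with (d * (2 / d)) by (field; lra). apply Rle_ge, Rmult_le_compat_l; lra. }
    assert (H1 : d <= / (INR q * m)) by lra.
    apply Rmult_le_compat_r with (r := INR q * m) in H1; [|nra].
    rewrite Rinv_l in H1 by nra. nra.
  - eapply Rle_trans; [exact Hy|]. rewrite Rpower_Ropp.
    replace 2 with (1 + 1) by ring. rewrite Rpower_plus, Rpower_1 by lra.
    apply Rinv_le_contravar; nra.
Qed.

(** * Coverings and Hausdorff dimension *)

Lemma rpow_ge0 (x a : R) : 0 <= rpow x a.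
Proof. unfold rpow. destruct (Req_EM_T x 0); [lra|]. left. apply Rpower_pos. Qed.

Lemma Sum_grid (f : nat -> nat -> R) (m n : nat) : (0 < m)%nat ->
  Sum (fun c => f (c / m)%nat (c mod m)%nat) (n * m) = Sum (fun i => Sum (f i) m) n.
Proof.
  intros Hm. induction n as [|n IH]; [reflexivity|].
  replace (S n * m)%nat with (n * m + m)%nat by lia. rewrite Sum_split, IH. cbn [Sum]. f_equal.
  apply Sum_ext. intros k Hk.
  rewrite Nat.add_comm, Nat.div_add, Nat.Div0.mod_add, Nat.div_small, Nat.mod_small by lia.
  reflexivity.
Qed.

(** Both coordinates of the [k]-th pair are at most [k], so the first [n] pairs lie in an [n] by [n]
    square, flattened by [i * n + j]. *)
Lemma Sum_cantor_le (f : nat -> nat -> R) (n : nat) :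
  (forall i j, 0 <= f i j) ->
  Sum (fun k => f (fst (Cantor.of_nat k)) (snd (Cantor.of_nat k))) n
  <= Sum (fun i => Sum (f i) n) n.
Proof.
  intros Hf. destruct (Nat.eq_dec n 0) as [->|Hn]; [simpl; lra|].
  assert (B : forall k, (k < n)%nat ->
    (fst (Cantor.of_nat k) < n /\ snd (Cantor.of_nat k) < n)%nat).
  { intros k Hk. pose proof (Cantor.cancel_to_of k) as E. destruct (Cantor.of_nat k) as [x y].
    pose proof (Cantor.to_nat_non_decreasing x y). simpl. lia. }
  set (g := fun k => (fst (Cantor.of_nat k) * n + snd (Cantor.of_nat k))%nat).
  assert (G : forall k, (k < n)%nat ->
    (g k / n = fst (Cantor.of_nat k) /\ g k mod n = snd (Cantor.of_nat k))%nat).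
  { intros k Hk. destruct (B k Hk). unfold g.
    rewrite Nat.add_comm, Nat.div_add, Nat.Div0.mod_add, Nat.div_small, Nat.mod_small by lia. lia. }
  rewrite <- (Sum_grid f n n) by lia.
  eapply Rle_trans; [|apply (Sum_injective_le g (n * n) n)].
  - right. apply Sum_ext. intros k Hk. destruct (G k Hk) as [-> ->]. reflexivity.
  - intros. apply Hf.
  - intros k Hk. destruct (B k Hk). unfold g. nia.
  - intros k l Hk Hl E. destruct (G k Hk) as [G1 G2]. destruct (G l Hl) as [G3 G4].
    rewrite E in G1, G2. apply Cantor.of_nat_inj.
    rewrite (surjective_pairing (Cantor.of_nat k)), (surjective_pairing (Cantor.of_nat l)).
    congruence.
Qed.

Lemma hausdorff_null_of_double_cover (s : R) (E : Defs.C -> Prop) :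
  (forall delta eps, 0 < delta -> 0 < eps ->
    exists (U : nat -> nat -> Defs.C -> Prop) (r : nat -> nat -> R),
      (forall z, E z -> exists i j, U i j z) /\
      (forall i j, 0 <= r i j <= delta /\ diam_le (U i j) (r i j)) /\
      (forall n, Sum (fun i => Sum (fun j => rpow (r i j) s) n) n <= eps)) ->
  hausdorff_null s E.
Proof.
  intros H delta eps Hd He. destruct (H delta eps Hd He) as (U & r & H1 & H2 & H3).
  exists (fun k => U (fst (Cantor.of_nat k)) (snd (Cantor.of_nat k))),
    (fun k => r (fst (Cantor.of_nat k)) (snd (Cantor.of_nat k))).
  split; [|split].
  - intros z Hz. destruct (H1 z Hz) as (i & j & Hij). exists (Cantor.to_nat (i, j)).
    rewrite Cantor.cancel_of_to. exact Hij.
  - intros k. apply H2.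
  - intros n. rewrite sum_f_R0_Sum. eapply Rle_trans; [|apply (H3 (S n))].
    apply (Sum_cantor_le (fun i j => rpow (r i j) s)). intros. apply rpow_ge0.
Qed.

Lemma Sum_geometric_le (e : R) (n : nat) : 0 < e -> Sum (fun i => e * (1 / 2) ^ S i) n <= e.
Proof.
  intros He. assert (Sum (fun i => e * (1 / 2) ^ S i) n = e - e * (1 / 2) ^ n) as ->.
  { induction n as [|n IH]; cbn [Sum]; [simpl; lra|]. rewrite IH. simpl. lra. }
  assert (0 < (1 / 2) ^ n) by (apply pow_lt; lra). nra.
Qed.

Lemma hausdorff_null_countable_union (s : R) (E : nat -> Defs.C -> Prop) :
  (forall j, hausdorff_null s (E j)) -> hausdorff_null s (fun z => exists j, E j z).
Proof.
  intros H. apply hausdorff_null_of_double_cover. intros delta eps Hd He.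
  set (P := fun (j : nat) (Ur : (nat -> Defs.C -> Prop) * (nat -> R)) =>
      (forall z, E j z -> exists i, fst Ur i z) /\
      (forall i, 0 <= snd Ur i <= delta /\ diam_le (fst Ur i) (snd Ur i)) /\
      (forall n, sum_f_R0 (fun i => rpow (snd Ur i) s) n <= eps * (1 / 2) ^ S j)).
  assert (HP : forall j, exists Ur, P j Ur).
  { intros j. destruct (H j delta (eps * (1 / 2) ^ S j) Hd) as (U & r & HUr).
    - apply Rmult_lt_0_compat; [lra|apply pow_lt; lra].
    - exists (U, r). exact HUr. }
  set (F := fun j => proj1_sig (constructive_indefinite_description _ (HP j))).
  assert (HF : forall j, P j (F j)) by (intros j; apply (proj2_sig (constructive_indefinite_description _ (HP j)))).
  exists (fun j => fst (F j)), (fun j => snd (F j)). split; [|split].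
  - intros z [j Hz]. exists j. apply (HF j), Hz.
  - intros i j. apply (HF i).
  - intros n. eapply Rle_trans; [|apply (Sum_geometric_le eps n He)].
    apply Sum_le. intros j _. destruct n as [|n].
    + cbn [Sum]. left. apply Rmult_lt_0_compat; [lra|apply pow_lt; lra].
    + rewrite <- sum_f_R0_Sum. apply (HF j).
Qed.

Lemma hausdorff_null_subset (s : R) (E F : Defs.C -> Prop) :
  (forall z, E z -> F z) -> hausdorff_null s F -> hausdorff_null s E.
Proof.
  intros HEF H delta eps Hd He. destruct (H delta eps Hd He) as (U & r & H1 & H2).
  exists U, r. split; [intros z Hz; apply H1, HEF, Hz|exact H2].
Qed.

Lemma cdist_diag (z : Defs.C) : cdist z z = 0.
Proof. unfold cdist, cnorm. cbn [fst snd]. rewrite !Rminus_diag, Rmult_0_r, Rplus_0_r. apply sqrt_0. Qed.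

Lemma hausdorff_null_point (s : R) (z0 : Defs.C) : hausdorff_null s (fun z => z = z0).
Proof.
  intros delta eps Hd He. exists (fun _ z => z = z0), (fun _ => 0). split; [|split].
  - intros z Hz. exists O. exact Hz.
  - intros _. split; [lra|]. intros z w -> ->. rewrite cdist_diag. lra.
  (* The sum is zero by the convention [rpow 0 s = 0]. *)
  - intros n. rewrite sum_f_R0_Sum, Sum_const. unfold rpow.
    destruct (Req_EM_T 0 0); lra.
Qed.

Lemma hausdorff_null_phi_rationals (s : R) :
  hausdorff_null s (image phi (fun t => ~ irrational (2 * PI * t))).
Proof.
  apply hausdorff_null_subset with
    (* The numerator, an integer, is a difference of two naturals, so three countable unions over
       [nat] exhaust the rationals. *)
    (fun z => exists i, exists j, exists k, z = phi ((INR j - INR k) / INR (S i) / (2 * PI))).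
  - intros z (t & Ht & ->). unfold irrational in Ht.
    apply not_all_ex_not in Ht as [p Ht]. apply not_all_ex_not in Ht as [q Ht].
    apply imply_to_and in Ht as [Hq Ht]. apply NNPP in Ht.
    exists (q - 1)%nat, (Z.to_nat p), (Z.to_nat (- p)). f_equal.
    replace (S (q - 1)) with q by lia.
    assert (INR (Z.to_nat p) - INR (Z.to_nat (- p)) = IZR p) as ->.
    { rewrite !INR_IZR_INZ, <- minus_IZR. f_equal. lia. }
    rewrite <- Ht. field. pose proof PI_RGT_0. lra.
  - apply hausdorff_null_countable_union. intros i.
    apply hausdorff_null_countable_union. intros j.
    apply hausdorff_null_countable_union. intros k. apply hausdorff_null_point.
Qed.

Lemma hausdorff_null_union (s : R) (E F : Defs.C -> Prop) :
  hausdorff_null s E -> hausdorff_null s F -> hausdorff_null s (fun z => E z \/ F z).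
Proof.
  intros HE HF.
  apply hausdorff_null_subset with (fun z => exists j, (match j with O => E | _ => F end) z).
  - intros z [Hz|Hz]; [exists O|exists 1%nat]; exact Hz.
  - apply hausdorff_null_countable_union. intros [|j]; assumption.
Qed.

Lemma Rpower_neg_small (a e : R) : 0 < a -> 0 < e ->
  exists N : nat, (0 < N)%nat /\ forall n, (N <= n)%nat -> Rpower (INR n) (- a) <= e.
Proof.
  intros Ha He. set (y := Rpower e (- / a)). assert (Hy : 0 < y) by apply Rpower_pos.
  exists (S (nfloor y)). split; [lia|]. intros n Hn.
  pose proof (nfloor_bounds y ltac:(lra)) as F.
  apply le_INR in Hn. rewrite S_INR in Hn.
  rewrite Rpower_Ropp.
  apply Rle_trans with (/ Rpower y a).
  - apply Rinv_le_contravar; [apply Rpower_pos|]. apply Rle_Rpower_l; lra.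
  - unfold y. rewrite Rpower_mult. replace (- / a * a) with (- (1)) by (field; lra).
    rewrite Rpower_Ropp, Rpower_1, Rinv_inv by lra. lra.
Qed.

Lemma Rpower_telescope (eta : R) (m : nat) : 0 < eta -> (0 < m)%nat ->
  Rpower (INR (S m)) (- (1 + eta)) <= / eta * (Rpower (INR m) (- eta) - Rpower (INR (S m)) (- eta)).
Proof.
  intros He Hm. assert (Pm : 0 < INR m) by (apply lt_0_INR; lia). rewrite S_INR.
  destruct (MVT_cor2 (fun x => Rpower x (- eta)) (fun x => - eta * Rpower x (- eta - 1))
     (INR m) (INR m + 1)) as (c & E & Hc); [lra| |].
  - intros c Hc. apply derivable_pt_lim_power. lra.
  - replace (INR m + 1 - INR m) with 1 in E by ring. rewrite Rmult_1_r in E.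
    replace (Rpower (INR m) (- eta) - Rpower (INR m + 1) (- eta))
      with (eta * Rpower c (- eta - 1)) by lra.
    rewrite <- Rmult_assoc, Rinv_l, Rmult_1_l by lra.
    replace (- eta - 1) with (- (1 + eta)) by ring. rewrite !Rpower_Ropp.
    apply Rinv_le_contravar; [apply Rpower_pos|]. apply Rle_Rpower_l; lra.
Qed.

Lemma Sum_Rpower_tail (eta : R) (m n : nat) : 0 < eta -> (0 < m)%nat ->
  Sum (fun i => Rpower (INR (S (m + i))) (- (1 + eta))) n <= / eta * Rpower (INR m) (- eta).
Proof.
  intros He Hm.
  assert (IE : 0 < / eta) by (apply Rinv_0_lt_compat; lra).
  assert (Sum (fun i => Rpower (INR (S (m + i))) (- (1 + eta))) n
     <= / eta * (Rpower (INR m) (- eta) - Rpower (INR (m + n)) (- eta))) as H.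
  { induction n as [|n IH].
    - rewrite Nat.add_0_r. simpl. lra.
    - cbn [Sum]. rewrite Nat.add_succ_r.
      pose proof (Rpower_telescope eta (m + n) He ltac:(lia)). lra. }
  pose proof (Rpower_pos (INR (m + n)) (- eta)). nra.
Qed.

(** The factor 2 comes from comparing coordinates and replaces the sharp triangle inequality; it
    only affects constants. *)
Lemma cdist_center (z w c : Defs.C) : cdist z w <= 2 * (cdist z c + cdist w c).
Proof.
  assert (F : forall u v : Defs.C, Rabs (fst u - fst v) <= cdist u v /\ Rabs (snd u - snd v) <= cdist u v).
  { intros u v. unfold cdist, cnorm. cbn [fst snd].
    split; rewrite <- sqrt_Rsqr_abs; apply sqrt_le_1_alt; unfold Rsqr;
      pose proof (Rle_0_sqr (fst u - fst v)); pose proof (Rle_0_sqr (snd u - snd v));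
      unfold Rsqr in *; lra. }
  eapply Rle_trans; [apply cdist_le_components|].
  destruct (F z c), (F w c).
  pose proof (Rabs_triang (fst z - fst c) (- (fst w - fst c))).
  pose proof (Rabs_triang (snd z - snd c) (- (snd w - snd c))).
  rewrite Rabs_Ropp in *.
  replace (fst z - fst w) with (fst z - fst c + - (fst w - fst c)) by ring.
  replace (snd z - snd w) with (snd z - snd c + - (snd w - snd c)) by ring. lra.
Qed.

Lemma Sum_indicator_le (a : R) (m n : nat) : 0 <= a ->
  Sum (fun j => if (j <? m)%nat then a else 0) n <= INR m * a.
Proof.
  intros Ha. destruct (le_lt_dec n m).
  - apply Rle_trans with (Sum (fun _ => a) n).
    + apply Sum_le. intros. destruct (_ <? _)%nat; lra.
    + rewrite Sum_const. apply Rmult_le_compat_r; [lra|]. apply le_INR. lia.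
  - replace n with (m + (n - m))%nat by lia. rewrite Sum_split.
    rewrite (Sum_ext _ (fun _ => a) m), Sum_const.
    + rewrite (Sum_ext _ (fun _ => 0)), Sum_const; [lra|].
      intros k _. destruct (Nat.ltb_spec (m + k) m); [lia|reflexivity].
    + intros k Hk. destruct (Nat.ltb_spec k m); [reflexivity|lia].
Qed.

Definition well_approximable (tau x : R) : Prop :=
  forall Q0 : nat, exists (p : Z) (q : nat), (0 < q)%nat /\ (Q0 <= q)%nat /\
    rel_prime p (Z.of_nat q) /\ Rabs (x - IZR p / INR q) <= Rpower (INR q) (- tau).

Lemma phi_diff_near_rational (tau eps : R) : 2 <= tau -> 0 < eps ->
  exists K, 0 < K /\ forall (p : Z) (q : nat) (t : R),
    (0 < q)%nat -> rel_prime p (Z.of_nat q) ->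
    Rabs (2 * PI * t - IZR p / INR q) <= Rpower (INR q) (- tau) ->
    cdist (phi t) (phi (IZR p / INR q / (2 * PI))) <= K * Rpower (INR q) (- ((tau + 1) / 2 - tau * eps)).
Proof.
  intros Ht He. destruct (phi_diff_le_Rpower eps He) as (K & HK & H).
  exists K. split; [exact HK|]. intros p q t Hq Hpq Hd.
  assert (Hq' : 1 <= INR q) by (apply (le_INR 1); lia).
  set (r := Rpower (INR q) (- tau)) in *.
  assert (E0 : 2 * PI * (IZR p / INR q / (2 * PI)) = IZR p / INR q)
    by (field; pose proof PI_RGT_0; lra).
  assert (Hr : 0 < r) by apply Rpower_pos.
  eapply Rle_trans; [apply (H r (INR q))|].
  - split; [exact Hr|]. rewrite <- (Rpower_O (INR q)) by lra. apply Rle_Rpower; lra.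
  - exact Hq'.
  - replace (INR q * INR q * r) with (Rpower (INR q) (2 - tau)).
    + rewrite <- (Rpower_O (INR q)) by lra. apply Rle_Rpower; lra.
    + unfold r. replace (2 - tau) with (1 + 1 + - tau) by ring.
      rewrite !Rpower_plus, !Rpower_1 by lra. ring.
  - rewrite E0. exact Hd.
  - intros y Hy. rewrite E0 in Hy. apply (approximable_near_rational tau p); assumption.
  - right. f_equal. unfold r. rewrite Rpower_mult, <- Rpower_plus. f_equal. field.
Qed.

(** The bounded range leaves about [q] numerators for each denominator [q]. Each image piece has
    diameter of order [q^(-kappa)], so the row for [q] costs about
    [q^(1 - kappa s) = q^(-(1 + eta))], which is summable. *)
Lemma hausdorff_null_well_approximable (tau s : R) (B : nat) :
  2 <= tau -> 0 < s -> 4 < s * (tau + 1) ->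
  hausdorff_null s (image phi (fun t => Rabs (2 * PI * t) <= INR B /\ well_approximable tau (2 * PI * t))).
Proof.
  intros Ht Hs Hst.
  assert (H2s : 2 / s < (tau + 1) / 2).
  { apply Rmult_lt_reg_r with s; [lra|]. replace (2 / s * s) with 2 by (field; lra). lra. }
  (* The loss is chosen so that [kappa] is the midpoint of [2/s] and [(tau+1)/2]; hence
     [kappa s > 2]. *)
  set (eps0 := ((tau + 1) / 2 - 2 / s) / (2 * tau)).
  assert (He0 : 0 < eps0) by (apply Rdiv_lt_0_compat; lra).
  destruct (phi_diff_near_rational tau eps0 Ht He0) as (K & HK & Hphi).
  set (kappa := (tau + 1) / 2 - tau * eps0) in *.
  assert (Hk : kappa = ((tau + 1) / 2 + 2 / s) / 2) by (unfold kappa, eps0; field; lra).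
  assert (P2s : 0 < 2 / s) by (apply Rdiv_lt_0_compat; lra).
  assert (Hk0 : 0 < kappa) by lra.
  set (eta := kappa * s - 2).
  assert (Heta : 0 < eta).
  { unfold eta. rewrite Hk. replace (((tau + 1) / 2 + 2 / s) / 2 * s - 2) with ((s * (tau + 1) - 4) / 4)
      by (field; lra). lra. }
  apply hausdorff_null_of_double_cover. intros delta eps Hd He.
  set (A := (2 * INR B + 3) * Rpower (4 * K) s).
  pose proof (pos_INR B) as HB.
  assert (HA : 0 < A) by (apply Rmult_lt_0_compat; [lra|apply Rpower_pos]).
  destruct (Rpower_neg_small kappa (delta / (4 * K)) Hk0) as (N1 & HN1 & Hsmall1);
    [apply Rdiv_lt_0_compat; lra|].
  destruct (Rpower_neg_small eta (eps * eta / A) Heta) as (N2 & HN2 & Hsmall2);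
    [apply Rdiv_lt_0_compat; nra|].
  (* Denominators beyond [N1] give diameters at most [delta]; starting beyond [N2] makes the tail at
     most [eps]. *)
  set (m := max N1 N2).
  set (den := fun i => S (m + i)).
  (* The shift makes [j] below [cnt i] run through all numerators of modulus at most
     [(B + 1) * den i]. *)
  set (num := fun i j => (Z.of_nat j - Z.of_nat ((B + 1) * den i))%Z).
  set (d := fun i => 4 * K * Rpower (INR (den i)) (- kappa)).
  set (cnt := fun i => (2 * (B + 1) * den i + 1)%nat).
  assert (Hden : forall i, 1 <= INR (den i)) by (intros i; apply (le_INR 1); unfold den; lia).
  assert (Hd0 : forall i, 0 < d i).
  { intros i. unfold d. apply Rmult_lt_0_compat; [lra|apply Rpower_pos]. }
  (* Beyond [cnt i] the sets are empty and get diameter 0, which costs nothing as [rpow 0 s = 0]. *)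
  exists (fun i j z => (j < cnt i)%nat /\ exists t, z = phi t /\ rel_prime (num i j) (Z.of_nat (den i)) /\
       Rabs (2 * PI * t - IZR (num i j) / INR (den i)) <= Rpower (INR (den i)) (- tau)),
    (fun i j => if (j <? cnt i)%nat then d i else 0).
  split; [|split].
  - intros z (t & (HtB & Hw) & ->). destruct (Hw (S m)) as (p & q & Hq & Hqm & Hpq & Hpd).
    assert (Hq' : 1 <= INR q) by (apply (le_INR 1); lia).
    exists (q - S m)%nat, (Z.to_nat (p + Z.of_nat ((B + 1) * q))).
    assert (Ed : den (q - S m)%nat = q) by (unfold den; lia).
    unfold num, cnt. rewrite !Ed.
    assert (Hp : Rabs (IZR p) <= (INR B + 1) * INR q).
    { assert (Rabs (IZR p / INR q) <= INR B + 1).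
      { replace (IZR p / INR q) with (2 * PI * t + - (2 * PI * t - IZR p / INR q)) by ring.
        eapply Rle_trans; [apply Rabs_triang|]. rewrite Rabs_Ropp.
        assert (Rpower (INR q) (- tau) <= 1); [|lra].
        rewrite <- (Rpower_O (INR q)) by lra. apply Rle_Rpower; lra. }
      replace (IZR p) with (IZR p / INR q * INR q) by (field; lra).
      rewrite Rabs_mult, (Rabs_pos_eq (INR q)) by lra. apply Rmult_le_compat_r; lra. }
    assert (HpZ : (Z.abs p <= Z.of_nat ((B + 1) * q))%Z).
    { apply le_IZR. rewrite abs_IZR, <- INR_IZR_INZ, mult_INR, plus_INR. simpl. exact Hp. }
    split; [lia|]. exists t.
    replace (Z.of_nat (Z.to_nat (p + Z.of_nat ((B + 1) * q))) - Z.of_nat ((B + 1) * q))%Z with p by lia.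
    split; [reflexivity|]. split; assumption.
  - intros i j. destruct (Nat.ltb_spec j (cnt i)) as [Hj|Hj].
    + split.
      * split; [left; apply Hd0|]. unfold d.
        specialize (Hsmall1 (den i) ltac:(unfold den, m; lia)).
        apply Rmult_le_compat_l with (r := 4 * K) in Hsmall1; [|lra].
        replace (4 * K * (delta / (4 * K))) with delta in Hsmall1 by (field; lra). exact Hsmall1.
      * intros z w (_ & t1 & -> & Hc & H1) (_ & t2 & -> & _ & H2).
        apply Hphi in H1; [|unfold den; lia|exact Hc]. apply Hphi in H2; [|unfold den; lia|exact Hc].
        eapply Rle_trans; [apply (cdist_center _ _ (phi (IZR (num i j) / INR (den i) / (2 * PI))))|].
        unfold d. lra.
    + split; [lra|]. intros z w [H _]. lia.
  - intros n.
    assert (row : forall i, Sum (fun j => rpow (if (j <? cnt i)%nat then d i else 0) s) n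
               <= A * Rpower (INR (den i)) (- (1 + eta))).
    { intros i.
      rewrite (Sum_ext _ (fun j => if (j <? cnt i)%nat then Rpower (d i) s else 0)).
      2: { intros j _. destruct (j <? cnt i)%nat; unfold rpow.
           - destruct (Req_EM_T (d i) 0) as [E|]; [|reflexivity]. specialize (Hd0 i). lra.
           - destruct (Req_EM_T 0 0); lra. }
      eapply Rle_trans; [apply Sum_indicator_le; left; apply Rpower_pos|].
      unfold d. rewrite <- Rpower_mult_distr by (try apply Rpower_pos; lra). rewrite Rpower_mult.
      assert (Hcnt : INR (cnt i) <= (2 * INR B + 3) * INR (den i)).
      { unfold cnt. rewrite plus_INR, !mult_INR, plus_INR. simpl (INR 2). simpl (INR 1).
        specialize (Hden i). nra. }
      replace (A * Rpower (INR (den i)) (- (1 + eta)))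
        with ((2 * INR B + 3) * INR (den i) * (Rpower (4 * K) s * Rpower (INR (den i)) (- kappa * s))).
      - apply Rmult_le_compat_r; [|exact Hcnt].
        left. apply Rmult_lt_0_compat; apply Rpower_pos.
      - unfold A. replace (- (1 + eta)) with (1 + - kappa * s) by (unfold eta; ring).
        rewrite Rpower_plus, Rpower_1 by (specialize (Hden i); lra). ring. }
    apply Rle_trans with (Sum (fun i => A * Rpower (INR (S (m + i))) (- (1 + eta))) n).
    + apply Sum_le. intros i _. apply row.
    + rewrite Sum_scal.
      pose proof (Sum_Rpower_tail eta m n Heta ltac:(lia)) as Ht1.
      specialize (Hsmall2 m ltac:(lia)).
      apply Rle_trans with (A * (/ eta * (eps * eta / A))).
      * apply Rmult_le_compat_l; [lra|]. eapply Rle_trans; [exact Ht1|].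
        apply Rmult_le_compat_l; [left; apply Rinv_0_lt_compat; lra|exact Hsmall2].
      * right. field. lra.
Qed.

Lemma holder_at_of_badly_approximable (tau eps t : R) :
  2 <= tau -> 0 < eps < 1 / 2 -> irrational (2 * PI * t) -> ~ well_approximable tau (2 * PI * t) ->
  holder_at phi t (1 / 2 + / (2 * tau) - eps).
Proof.
  intros Ht He Hirr Hbad. pose proof PI_RGT_0 as HPI.
  apply not_all_ex_not in Hbad as [Q0 Hbad].
  destruct (approximable_of_badly_approximable tau (2 * PI * t) Q0 Ht Hirr) as (delta & Hdelta & Happ).
  { intros p q Hq HQ Hpq. apply Rnot_le_lt. intros Hle. apply Hbad. exists p, q. auto. }
  destruct (phi_diff_le_Rpower eps ltac:(lra)) as (K & HK & H).
  set (a := 1 / 2 + / (2 * tau) - eps).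
  assert (It : 0 < / tau <= / 2).
  { split; [apply Rinv_0_lt_compat; lra|apply Rinv_le_contravar; lra]. }
  assert (E2 : / (2 * tau) = / tau / 2) by (field; lra).
  (* The polynomial is the constant [phi t]. The factor [(2 PI)^a] comes from [r = 2 PI |h|]. *)
  exists (fun _ => phi t), O, (K * Rpower (2 * PI) a), (delta / (2 * PI)).
  split; [simpl; unfold a; lra|]. split; [apply Rmult_lt_0_compat; [lra|apply Rpower_pos]|].
  split; [apply Rdiv_lt_0_compat; lra|]. intros h Hh.
  assert (Ec : cpoly (fun _ => phi t) 0 h = phi t).
  { unfold cpoly. simpl. rewrite !Rmult_1_r. symmetry. apply surjective_pairing. }
  rewrite Ec. unfold rpow. destruct (Req_EM_T (Rabs h) 0) as [E|Hne].
  - assert (h = 0) as -> by (destruct (Req_dec h 0); [assumption|]; apply Rabs_no_R0 in H0; lra).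
    rewrite Rplus_0_r, cdist_diag. lra.
  - assert (Ph : 0 < Rabs h) by (pose proof (Rabs_pos h); lra).
    set (r := 2 * PI * Rabs h).
    assert (Hr : 0 < r) by (unfold r; nra).
    assert (Hrd : r < delta).
    { unfold r. apply Rmult_lt_compat_l with (r := 2 * PI) in Hh; [|lra].
      replace (2 * PI * (delta / (2 * PI))) with delta in Hh by (field; lra). exact Hh. }
    set (T := Rpower r (- / tau)).
    eapply Rle_trans; [apply (H r T)|].
    + lra.
    + unfold T. rewrite Rpower_Ropp, <- Rinv_1.
      apply Rinv_le_contravar; [apply Rpower_pos|apply Rpower_le_1; lra].
    + rewrite <- (Rpower_1 r) by lra. unfold T. rewrite <- !Rpower_plus. apply Rpower_le_1; lra.
    + replace (2 * PI * (t + h) - 2 * PI * t) with (2 * PI * h) by ring.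
      rewrite Rabs_mult, (Rabs_pos_eq (2 * PI)) by lra. unfold r. lra.
    + intros y Hy. apply Happ; [lra|exact Hy].
    + right. rewrite Rmult_assoc. f_equal. rewrite Rpower_mult_distr by lra. fold r.
      unfold T. rewrite Rpower_mult, <- Rpower_plus. f_equal. unfold a. rewrite E2. field. lra.
Qed.

(** The constraints are [tau >= 2], [tau > 4/s - 1] and [tau < w = 1/(2 alpha - 1)]. They are
    compatible because [alpha < 3/4] means [w > 2], and [4/(w+1)] equals [(4 alpha - 2)/alpha]. At
    [alpha = 1/2] there is no upper constraint. *)
Lemma exists_approximation_exponent (alpha s : R) :
  1 / 2 <= alpha < 3 / 4 -> 0 < s -> (4 * alpha - 2) / alpha < s ->
  exists tau, 2 <= tau /\ tau * (2 * alpha - 1) < 1 /\ 4 < s * (tau + 1).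
Proof.
  intros Ha Hs Hsa. assert (P4 : 0 < 4 / s) by (apply Rdiv_lt_0_compat; lra).
  assert (E4 : s * (4 / s) = 4) by (field; lra).
  destruct (Req_dec alpha (1 / 2)) as [->|Hne].
  - exists (2 + 4 / s). split; [lra|]. split; [lra|]. nra.
  - set (w := / (2 * alpha - 1)).
    assert (Ew : w * (2 * alpha - 1) = 1) by (unfold w; field; lra).
    assert (Hw : 2 < w) by nra.
    assert (Hsw : 4 < s * (w + 1)).
    { apply Rmult_lt_compat_r with (r := w + 1) in Hsa; [|lra].
      replace ((4 * alpha - 2) / alpha * (w + 1)) with 4 in Hsa; [lra|].
      unfold w. field. lra. }
    set (u := Rmax 2 (4 / s - 1)).
    assert (Hu2 : 2 <= u) by apply Rmax_l.
    assert (Hu3 : 4 / s - 1 <= u) by apply Rmax_r.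
    assert (Hu : u < w).
    { apply Rmax_lub_lt; [lra|]. apply Rmult_lt_reg_l with s; [lra|]. lra. }
    exists ((u + w) / 2). split; [lra|]. split; [|nra].
    apply Rlt_le_trans with (w * (2 * alpha - 1)); [apply Rmult_lt_compat_r; lra|lra].
Qed.

Lemma hausdorff_null_low_holder (alpha s : R) :
  1 / 2 <= alpha <= 3 / 4 -> 0 < s -> (4 * alpha - 2) / alpha < s ->
  hausdorff_null s (image phi (fun x => exists beta, beta <= alpha /\ D phi beta x)).
Proof.
  intros Ha Hs Hsa.
  assert (exists tau, 2 <= tau /\ 4 < s * (tau + 1) /\ forall t beta,
     beta <= alpha -> D phi beta t -> irrational (2 * PI * t) -> well_approximable tau (2 * PI * t))
    as (tau & Ht & Hst & Hw).
  (* At [3/4] the condition [tau < 1/(2 alpha - 1) = 2] would conflict with [tau >= 2], so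
     Dirichlet's theorem takes over. *)
  { destruct (Req_dec alpha (3 / 4)) as [->|Hne].
    - exists 2. split; [lra|]. split.
      + replace ((4 * (3 / 4) - 2) / (3 / 4)) with (4 / 3) in Hsa by field. lra.
      + intros t beta _ _ Hirr Q0. apply irrational_dirichlet, Hirr.
    - destruct (exists_approximation_exponent alpha s) as (tau & Ht & Hta & Hst); [lra|lra|lra|].
      exists tau. split; [exact Ht|]. split; [exact Hst|].
      intros t beta Hb HD Hirr. apply NNPP. intros Hbad.
      assert (Hexp : alpha < 1 / 2 + / (2 * tau)).
      { apply Rmult_lt_reg_r with (2 * tau); [lra|].
        replace ((1 / 2 + / (2 * tau)) * (2 * tau)) with (tau + 1) by (field; lra). lra. }
      (* Giving up half of the gap leaves a Hoelder exponent still above [alpha], which contradicts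
         [beta <= alpha]. *)
      set (e := (1 / 2 + / (2 * tau) - alpha) / 2).
      assert (/ (2 * tau) <= / 4) by (apply Rinv_le_contravar; lra).
      assert (He : 0 < e < 1 / 2) by (unfold e; lra).
      pose proof (holder_at_of_badly_approximable tau e t Ht He Hirr Hbad) as Hh.
      destruct HD as [Hub _].
      assert (He' : 0 < 1 / 2 + / (2 * tau) - e) by (unfold e; lra).
      specialize (Hub _ (conj He' Hh)).
      unfold e in Hub. lra. }
  apply hausdorff_null_subset with
    (fun z => image phi (fun t => ~ irrational (2 * PI * t)) z \/
       exists B : nat, image phi (fun t => Rabs (2 * PI * t) <= INR B /\ well_approximable tau (2 * PI * t)) z).
  - intros z (t & (beta & Hb & HD) & ->).
    destruct (classic (irrational (2 * PI * t))) as [Hirr|Hirr].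
    + right. exists (S (nfloor (Rabs (2 * PI * t)))), t. split; [|reflexivity]. split.
      * pose proof (nfloor_bounds (Rabs (2 * PI * t)) (Rabs_pos _)). rewrite S_INR. lra.
      * apply (Hw t beta); assumption.
    + left. exists t. split; [exact Hirr|reflexivity].
  - apply hausdorff_null_union; [apply hausdorff_null_phi_rationals|].
    apply hausdorff_null_countable_union. intros B.
    apply hausdorff_null_well_approximable; assumption.
Qed.

(** The dimension is an [epsilon] choice, so existence of the infimum must be shown: the admissible
    set contains [s0] and is bounded below by 0, and completeness is applied to its reflection. *)
Lemma hausdorff_dim_is_glb (E : Defs.C -> Prop) (s0 : R) : 0 < s0 -> hausdorff_null s0 E ->
  is_glb (fun s => 0 < s /\ hausdorff_null s E) (hausdorff_dim E).
Proof.
  intros Hs0 H. unfold hausdorff_dim. apply epsilon_spec.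
  destruct (completeness (fun y => 0 < - y /\ hausdorff_null (- y) E)) as [m [Hm1 Hm2]].
  - exists 0. intros y [Hy _]. lra.
  - exists (- s0). rewrite Ropp_involutive. auto.
  - exists (- m). split.
    + intros x Hx. assert (- x <= m); [|lra]. apply Hm1. rewrite Ropp_involutive. exact Hx.
    + intros b Hb. specialize (Hm2 (- b)).
      assert (m <= - b); [|lra]. apply Hm2. intros y Hy. specialize (Hb _ Hy). lra.
Qed.

Theorem theorem2 (alpha : R) :
  1/2 <= alpha <= 3/4 ->
  hausdorff_dim (image phi (D phi alpha))
    <= hausdorff_dim (image phi (fun x => exists beta, beta <= alpha /\ D phi beta x)) /\
  hausdorff_dim (image phi (fun x => exists beta, beta <= alpha /\ D phi beta x))
    <= (4 * alpha - 2) / alpha.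
Proof.
  intros Ha. set (E := image phi (fun x => exists beta, beta <= alpha /\ D phi beta x)).
  assert (Hb : 0 <= (4 * alpha - 2) / alpha).
  { apply Rmult_le_pos; [lra|]. left. apply Rinv_0_lt_compat. lra. }
  set (b := (4 * alpha - 2) / alpha) in *.
  assert (HE : forall s, b < s -> hausdorff_null s E).
  { intros s Hs. apply hausdorff_null_low_holder; [exact Ha|lra|exact Hs]. }
  assert (Hsub : forall s, hausdorff_null s E -> hausdorff_null s (image phi (D phi alpha))).
  { intros s. apply hausdorff_null_subset. intros z (x & Hx & ->). exists x.
    split; [|reflexivity]. exists alpha. split; [lra|exact Hx]. }
  (* The value [b + 1] only witnesses that the sets of admissible exponents are nonempty. *)
  destruct (hausdorff_dim_is_glb E (b + 1) ltac:(lra) (HE (b + 1) ltac:(lra))) as [G1 G2].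
  destruct (hausdorff_dim_is_glb (image phi (D phi alpha)) (b + 1) ltac:(lra)
    (Hsub _ (HE (b + 1) ltac:(lra)))) as [G3 _].
  split.
  - apply G2. intros s [Hs Hn]. apply G3. split; [exact Hs|apply Hsub, Hn].
  - apply Rnot_lt_le. intros Hlt.
    set (s := (b + hausdorff_dim E) / 2).
    assert (Hs : b < s < hausdorff_dim E) by (unfold s; lra).
    assert (hausdorff_dim E <= s); [|lra].
    apply G1. split; [lra|]. apply HE. lra.
Qed.
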